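(* Let $\alpha>0$, let $\sigma$ be a nonzero finite Borel measure on the unit sphere $S\subset\mathbb{R}^d$, and let $\xi,\xi_1,\xi_2,\ldots$ be i.i.d. $\mathbb{R}^d$-valued random vectors with $\xi\in\mathrm{RV}(\alpha,\sigma)$. Let $r\in(0,1)$, and for each sample size $N$ let $n=[N^r]$ and $m=[N/n]$. Let $\tilde\sigma(\cdot)=\sigma(\cdot)/\sigma(S)$ and let $\hat\sigma_N=\frac1n\sum_{i=1}^n\delta_{\theta_{m,i}}$ (a random probability measure on $S$). Then, almost surely, $\hat\sigma_N$ converges weakly to $\tilde\sigma$ as $N\to\infty$.
   Context: $\|\cdot\|$ is the Euclidean norm on $\mathbb{R}^d$, $S=\{x\in\mathbb{R}^d:\|x\|=1\}$, $\delta_x$ is the Dirac mass at $x$, and $[a]$ is the integer part of $a$. $X\in\mathrm{RV}(\alpha,\sigma)$ means: there is a slowly varying function $\tilde L$ (i.e. $\tilde L(\lambda x)/\tilde L(x)\to1$ as $x\to\infty$ for all $\lambda>0$) such that, with $b_n=n^{1/\alpha}\tilde L(n)$, for all $\rho>0$ and all Borel $B\subset S$ with $\sigma(\partial B)=0$ ($\partial B$ the boundary of $B$ in $S$), $$\lim_{n\to\infty}n\,\mathbf{P}\{X/\|X\|\in B,\ \|X\|>\rho b_n\}=\sigma(B)\rho^{-\alpha}.$$ The sample $\xi_1,\ldots,\xi_N$ is divided into $n$ disjoint groups $G_{m,1},\ldots,G_{m,n}$ of $m$ vectors each (e.g. $G_{m,i}=\{\xi_{(i-1)m+1},\ldots,\xi_{im}\}$;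 leftover vectors are discarded). Let $\xi_{m,i}$ be the element of $G_{m,i}$ of largest norm (ties broken by taking the smallest index), and let $\theta_{m,i}=\xi_{m,i}/\|\xi_{m,i}\|\in S$ (a fixed arbitrary point of $S$ if $\xi_{m,i}=0$). *)

(* Defs.v *)
From HB Require Import structures.
From mathcomp Require Import all_boot all_order all_algebra.
From mathcomp Require Import all_classical all_reals all_analysis.

Set Implicit Arguments.
Unset Strict Implicit.
Unset Printing Implicit Defensive.

Import Order.TTheory GRing.Theory Num.Theory.
Import numFieldNormedType.Exports.

Local Open Scope classical_set_scope.
Local Open Scope ring_scope.

(* The library norm on 'rV[R]_n is the sup norm; the two norms induce the same
   topology, so the library's open sets of 'rV[R]_n are the Euclidean ones. *)
Definition enorm (R : realType) (n : nat) (x : 'rV[R]_n) : R :=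
  Num.sqrt (\sum_(i < n) x ord0 i ^+ 2).

(* The ambient space is R^(d+1): in dimension 0 the sphere is empty, carries no
   nonzero measure, and cannot be a (pointed) measurable type. *)
Definition sphere (R : realType) (d : nat) : Type :=
  set_type [set x : 'rV[R]_d.+1 | enorm x = 1].

Section sphere_instances.
Variables (R : realType) (d : nat).

Lemma enorm_delta : enorm (delta_mx ord0 ord0 : 'rV[R]_d.+1) = 1.
Proof.
rewrite /enorm (bigD1 ord0) //= big1 => [|i i0].
  by rewrite addr0 mxE eqxx expr1n sqrtr1.
by rewrite mxE eqxx (negbTE i0) expr0n.
Qed.

HB.instance Definition _ := SubType.on (sphere R d).
HB.instance Definition _ := Choice.on (sphere R d).
HB.instance Definition _ := PseudoMetric.on (sphere R d).
HB.instance Definition _ :=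
  isPointed.Build (sphere R d) (SigSub (mem_set enorm_delta)).

End sphere_instances.

Definition borel (T : ptopologicalType) := g_sigma_algebraType (@open T).

Definition boundary (T : topologicalType) (B : set T) : set T :=
  closure B `\` interior B.

Definition weak_cvg (R : realType) (T : ptopologicalType)
    (mu_ : nat -> {measure set (borel T) -> \bar R})
    (mu : {measure set (borel T) -> \bar R}) : Prop :=
  forall f : T -> R, continuous f -> (exists M : R, forall x, `|f x| <= M) ->
  (\int[mu_ n]_x (f x)%:E)%E @[n --> \oo] --> (\int[mu]_x (f x)%:E)%E.

Definition slowly_varying (R : realType) (L : R -> R) : Prop :=
  forall lambda : R, 0 < lambda -> L (lambda * x) / L x @[x --> +oo] --> (1 : R).

Section random_vectors.
Context (disp : measure_display) (Omega : measurableType disp) (R : realType).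
Variables (P : probability Omega R) (d : nat).
Local Notation E := 'rV[R]_d.+1.

(* Since 0^-1 = 0, the event excludes X = 0, where X / |X| is undefined. *)
Definition regularly_varying (X : {RV P >-> borel E}) (alpha : R)
    (sigma : {measure set (borel (sphere R d)) -> \bar R}) : Prop :=
  exists2 L : R -> R, slowly_varying L &
  let b (n : nat) := n%:R `^ alpha^-1 * L n%:R in
  forall (rho : R) (B : set (borel (sphere R d))),
    0 < rho -> measurable B -> sigma (boundary (B : set (sphere R d))) = 0%E ->
    (n%:R%:E * P [set w | [set val s | s in B] ((enorm (X w))^-1 *: (X w : E)) /\
                          (rho * b n < enorm (X w))%R])%E @[n --> \oo]
      --> (sigma B * (rho `^ (- alpha))%:E)%E.

Definition identically_distributed (X Y : {RV P >-> borel E}) : Prop :=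
  forall A : set (borel E), measurable A -> P (X @^-1` A) = P (Y @^-1` A).

Definition mutually_independent (X : nat -> {RV P >-> borel E}) : Prop :=
  forall (J : seq nat) (A : nat -> set (borel E)),
    uniq J -> (forall j, measurable (A j)) ->
    P (\bigcap_(j in [set` J]) X j @^-1` A j)
      = (\prod_(j <- J) P (X j @^-1` A j))%E.

End random_vectors.

Definition is_grouping (N n m : nat) (G : nat -> {set 'I_N}) : Prop :=
  (forall i, (i < n)%N -> #|G i| = m) /\
  (forall i j, (i < n)%N -> (j < n)%N -> i <> j -> [disjoint G i & G j]%bool).

(* The index in A of the largest norm, the smallest such index in case of ties;
   None only when A is empty. *)
Definition max_index (R : realType) (N d : nat) (x : nat -> 'rV[R]_d)
    (A : {set 'I_N}) : option 'I_N :=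
  [pick j in A | [forall k in A, (enorm (x k) < enorm (x j)) ||
                    ((enorm (x k) == enorm (x j)) && (j <= k)%N)]].

Definition group_max (R : realType) (N d : nat) (x : nat -> 'rV[R]_d)
    (A : {set 'I_N}) : 'rV[R]_d :=
  if max_index x A is Some j then x j else 0.

(* insubd returns s0 when its argument is off the sphere, i.e. when x = 0. *)
Definition direction (R : realType) (d : nat) (s0 : sphere R d)
    (x : 'rV[R]_d.+1) : sphere R d :=
  insubd s0 ((enorm x)^-1 *: x).

Definition nb_groups (R : realType) (r : R) (N : nat) : nat :=
  Num.truncn (N%:R `^ r).

Definition group_size (R : realType) (r : R) (N : nat) : nat :=
  (N %/ nb_groups r N)%N.

Definition sigma_hat (R : realType) (d : nat) (s0 : sphere R d) (r : R)
    (N : nat) (G : nat -> {set 'I_N}) (x : nat -> 'rV[R]_d.+1) :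
    {measure set (borel (sphere R d)) -> \bar R} :=
  let n := nb_groups r N in
  mscale ((n%:R : R)^-1)%:nng
    (msum (fun i => \d_(direction s0 (group_max x (G i)) : borel (sphere R d))) n).

(* The second argument of mnormalize is used only when the mass of sigma is
   zero or infinite. *)
Definition sigma_tilde (R : realType) (d : nat)
    (sigma : {measure set (borel (sphere R d)) -> \bar R}) :
    probability (borel (sphere R d)) R :=
  mnormalize sigma (\d_(point : borel (sphere R d))).

(* Main.v *)
Require Import Defs.
From mathcomp Require Import all_boot all_order all_algebra finmap.
From mathcomp Require Import all_classical all_reals all_analysis.
From mathcomp Require Import measurable_realfun ring lra.

(** For a [sigma]-continuity set [B], the direction of the largest of [m] vectors falls
    in [B] as soon as, for some level [t], exactly one vector exceeds [t] and it does so
    with direction in [B]. Slicing the levels finely, regular variation shows that these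
    disjoint events have total probability close to [sigma(B)/sigma(S)]. The events are
    independent across groups with equal probability, so the number of groups in which
    they occur is binomial; Chernoff's bound is exponentially small in [n = N^r], hence
    summable, and Borel-Cantelli gives almost surely
    [liminf sigma_hat_N(B) >= sigma_tilde(B)]. Applying this to the cells of countably
    many finite partitions of the sphere into continuity sets of vanishing mesh (grids
    of hyperplanes, shifted so as to carry no mass) yields weak convergence. *)

Set Implicit Arguments.
Unset Strict Implicit.
Unset Printing Implicit Defensive.

Import Order.TTheory GRing.Theory Num.Theory.
Import numFieldNormedType.Exports.

Local Open Scope classical_set_scope.
Local Open Scope ring_scope.

(** * Binomial tails and real estimates *)

Section real_estimates.
Context {R : realType}.
Implicit Types p q z h : R.

(* The probability that a binomial variable with parameters [k] and [p] is [< a]. *)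
Fixpoint binomial_tail p (k a : nat) : R :=
  match a, k with
  | 0%N, _ => 0
  | _.+1, 0%N => 1
  | a'.+1, k'.+1 => (1 - p) * binomial_tail p k' a + p * binomial_tail p k' a'
  end.

(** Markov's inequality for [z ^ X] with [X] binomial: the right-hand side is the generating
    function of [X] at [z], and [z ^ X >= z ^ a] on [X < a] because [z <= 1]. The induction follows
    the recursion of the tail. *)
Lemma binomial_tail_le p z k a : 0 <= p <= 1 -> 0 <= z <= 1 ->
  binomial_tail p k a * z ^+ a <= (1 - p + p * z) ^+ k.
Proof.
move=> /andP[p0 p1] /andP[z0 z1].
have r0 : 0 <= 1 - p + p * z by rewrite addr_ge0 ?subr_ge0 ?mulr_ge0.
elim: k a => [|k ih] [|a] /=; rewrite ?mul0r ?exprn_ge0 //.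
  by rewrite expr0 mul1r exprn_ile1.
have -> : ((1 - p) * binomial_tail p k a.+1 + p * binomial_tail p k a) * z ^+ a.+1
  = (1 - p) * (binomial_tail p k a.+1 * z ^+ a.+1)
    + p * z * (binomial_tail p k a * z ^+ a) by rewrite exprS; ring.
rewrite [leRHS]exprS [leRHS]mulrDl lerD // ler_wpM2l ?subr_ge0 ?mulr_ge0 //.
Qed.

(* Chernoff's bound with [z = 1 / (1 + e / 2)]. *)
Lemma binomial_tail_chernoff p q e n : 0 <= p <= 1 -> 0 <= q -> 0 < e ->
  q + e <= p ->
  binomial_tail p n (Num.truncn (n%:R * q)).+1
    <= expR (e / 2) * expR (- (e ^+ 2 / 4 * n%:R)).
Proof.
move=> /andP[p0 p1] q0 e0 qp.
set l := e / 2; have l0 : 0 < l by rewrite divr_gt0.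
set a := (Num.truncn _).+1.
have l1 : 0 < 1 + l by rewrite addr_gt0.
set z := (1 + l)^-1.
have z0 : 0 < z by rewrite invr_gt0.
have z1 : z <= 1 by rewrite invf_le1 // lerDl ltW.
have za : z ^+ a * (1 + l) ^+ a = 1.
  by rewrite -exprMn mulVf ?expr1n // gt_eqF.
have h1 : binomial_tail p n a <= (1 - p + p * z) ^+ n * (1 + l) ^+ a.
  have -> : binomial_tail p n a = binomial_tail p n a * z ^+ a * (1 + l) ^+ a.
    by rewrite -mulrA za mulr1.
  rewrite ler_wpM2r ?exprn_ge0 ?(ltW l1) //.
  by apply: binomial_tail_le; rewrite ?p0 ?p1 ?(ltW z0) ?z1.
apply: (le_trans h1).
have h2 : (1 - p + p * z) ^+ n <= expR (- (p * (l - l ^+ 2)) * n%:R).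
  rewrite expRM_natr lerXn2r ?nnegrE ?expR_ge0 //.
    by rewrite addr_ge0 ?subr_ge0 ?mulr_ge0 ?(ltW z0).
  apply: le_trans (expR_ge1Dx _).
  rewrite -addrA lerD2l -subr_ge0.
  have -> : - (p * (l - l ^+ 2)) - (- p + p * z) = p * ((1 - z) - l + l ^+ 2) by ring.
  rewrite mulr_ge0 //.
  (* This is [1 - z = l / (1 + l) >= l - l ^ 2] with its exact remainder. *)
  have -> : 1 - z - l + l ^+ 2 = l ^+ 3 * z.
    by rewrite /z; field; rewrite gt_eqF.
  by rewrite mulr_ge0 ?exprn_ge0 // ltW.
(* Here [a <= n * q + 1]; the [+ 1] is the source of the constant factor [exp(e / 2)]. *)
have h3 : (1 + l) ^+ a <= expR (l * (n%:R * q + 1)).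
  apply: (@le_trans _ _ (expR l ^+ a)).
    by rewrite lerXn2r ?nnegrE ?expR_ge0 ?(ltW l1) // expR_ge1Dx.
  rewrite -expRM_natr ler_expR ler_wpM2l ?(ltW l0) // /a -natr1 lerD2r.
  by case/andP: (truncn_itv (mulr_ge0 (ler0n R n) q0)).
apply: (le_trans (ler_pM _ _ h2 h3)).
- by rewrite exprn_ge0 // addr_ge0 ?subr_ge0 ?mulr_ge0 ?(ltW z0).
- by rewrite exprn_ge0 // ltW.
rewrite -!expRD ler_expR.
have hn : 0 <= (n%:R : R) by [].
(* With [l = e / 2], [p - q >= e] and [p <= 1], the bracket is at most
   [- l * e + l ^ 2 = - e ^ 2 / 4]. *)
have : n%:R * (l * q - p * (l - l ^+ 2)) <= n%:R * (- (e ^+ 2 / 4)).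
  apply: ler_wpM2l => //; rewrite /l.
  have : e * q + e * e <= e * p by rewrite -mulrDr ler_wpM2l // ltW.
  have : e ^+ 2 * p <= e ^+ 2 by rewrite ler_piMr // sqr_ge0.
  by rewrite expr2; lra.
rewrite /l; lra.
Qed.

(** Power [n] of [1 / (1 - x) = 1 + x / (1 - x) <= exp(x / (1 - x))], inverted. *)
Lemma one_minus_exp_ge (x : R) n : 0 <= x < 1 ->
  expR (- (n%:R * x / (1 - x))) <= (1 - x) ^+ n.
Proof.
move=> /andP[x0 x1]; have y0 : 0 < 1 - x by rewrite subr_gt0.
rewrite (_ : - _ = - (x / (1 - x)) * n%:R); last by ring.
rewrite expRM_natr lerXn2r ?nnegrE ?expR_ge0 ?(ltW y0) //.
rewrite expRN invf_ple ?posrE ?expR_gt0 //.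
apply: le_trans (expR_ge1Dx _).
by rewrite le_eqVlt; apply/orP; left; apply/eqP; field; rewrite gt_eqF.
Qed.

(* A lower Riemann sum of the integral of [exp(-u)] over the half line. *)
Lemma exp_riemann_sum_ge e : 0 < e -> exists h : R, 0 < h /\ exists K : nat,
  1 - e <= \sum_(j < K) h * expR (- (j.+2%:R * h)).
Proof.
(* With [x = exp(-h) >= 1 - h], starting the sum at [2 * h] costs the factor [x ^ 2], and stopping
   after [K] terms the factor [1 - x ^ K]. Together they leave at least
   [(1 - h) ^ 3 >= 1 - 3 * h]. *)
move=> e0; set h := Num.min e 1 / 4.
have h0 : 0 < h by rewrite divr_gt0 // lt_min e0 ltr01.
have he : 4 * h <= e by rewrite mulrC divfK // ge_min lexx.
have h1 : 4 * h <= 1 by rewrite mulrC divfK // ge_min lexx orbT.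
clearbody h; exists h; split => //.
(* Now [h * K >= 1 / h], whence [x ^ K <= 1 / (1 + h * K) <= h]. *)
set K := (Num.truncn (h^-1 ^+ 2)).+1; exists K.
set x := expR (- h).
have x1 : 1 - h <= x by exact: expR_ge1Dx.
have x0 : 0 < x by exact: expR_gt0.
apply: (@le_trans _ _ (x ^+ 2 * (1 - x ^+ K))).
  have xK : x ^+ K <= h.
    rewrite -expRM_natr mulNr expRN invf_ple ?posrE ?expR_gt0 //.
    apply: le_trans (expR_ge1Dx _).
    have /ltW : h^-1 ^+ 2 < K%:R by exact: truncnS_gt.
    move/(ler_wpM2l (ltW h0)); rewrite expr2 mulrA mulfV ?gt_eqF // mul1r.
    lra.
  have : (1 - h) ^+ 2 <= x ^+ 2 by rewrite lerXn2r // nnegrE; lra.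
  have : 1 - h <= 1 - x ^+ K by lra.
  move=> /(ler_pM _ _) /[apply]; rewrite sqr_ge0 => /(_ _ isT).
  have -> : 0 <= 1 - h by lra.
  move=> /(_ isT); rewrite mulrC [leRHS]mulrC; apply: le_trans.
  have : 0 <= h * h * (1 - h) by apply: mulr_ge0; [apply: mulr_ge0|]; lra.
  have : 0 <= h ^+ 2 by rewrite sqr_ge0.
  rewrite expr2 => a b; rewrite (_ : _ * _ = 1 - 3 * h + 2 * (h * h) + h * h * (1 - h)); last by ring.
  lra.
(* The geometric sum [1 - x ^ K = (1 - x) * \sum x ^ j], combined with [1 - x <= h]. *)
rewrite -[1 - x ^+ K]opprB subrX1 -mulNr opprB mulrA mulr_sumr ler_sum // => j _.
have -> : expR (- (j.+2%:R * h)) = x ^+ 2 * x ^+ j.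
  by rewrite -exprD addnC addn2 -expRM_natr mulNr mulrC.
rewrite [_ * (1 - x)]mulrC -mulrA ler_wpM2r //; last by lra.
by rewrite mulr_ge0 // exprn_ge0 // ltW.
Qed.

End real_estimates.

(** * Summability and the Borel-Cantelli lemma *)

Section summability.
Context {R : realType}.

Lemma nb_groups_ge (r : R) N : N%:R `^ r - 1 <= (nb_groups r N)%:R.
Proof.
by rewrite lerBlDr natr1 ltW // truncnS_gt.
Qed.

(** One term of the exponential series suffices: its degree [k.+1] satisfies [r * k.+1 >= 2], so
    [exp(- c * N ^ r)] is [O(N ^ -2)], which is compared with the telescoping differences of
    [1 / (N + 1)]. *)
Lemma summable_exp_nb_groups (c r : R) : 0 < c -> 0 < r ->
  (\sum_(N <oo) (expR (- (c * (nb_groups r N)%:R)))%:E < +oo)%E.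
Proof.
move=> c0 r0; set k := (Num.truncn (2 / r)).
have kr : 2 <= r * k.+1%:R.
  rewrite mulrC -ler_pdivrMr //; apply/ltW; exact: truncnS_gt.
set C := expR c * k.+1`!%:R / c ^+ k.+1.
have C0 : 0 <= C by rewrite divr_ge0 ?mulr_ge0 ?expR_ge0 ?exprn_ge0 // ltW.
(* The summand [2] covers [N = 0]; the factor [6] comes from [(x + 1) * (x + 2) <= 6 * x ^ 2] for
   [x >= 1]. *)
set D := 6 * C + 2.
have tD N : expR (- (c * (nb_groups r N)%:R)) <= D * (N.+1%:R^-1 - N.+2%:R^-1).
  have -> : N.+1%:R^-1 - N.+2%:R^-1 = (N.+1%:R * N.+2%:R)^-1 :> R.
    have : (0 : R) < N.+1%:R by rewrite ltr0n.
    rewrite -(natr1 N.+1); move: (N.+1%:R : R) => x x0.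
    by field; rewrite !gt_eqF ?addr_gt0.
  rewrite ler_pdivlMr ?mulr_gt0 ?ltr0n //.
  case: N => [|N].
    rewrite mul1r; apply: (@le_trans _ _ 2); last by rewrite lerDr mulr_ge0.
    by rewrite ler_piMl // expR_le1 oppr_le0 mulr_ge0 // ltW.
  set x : R := N.+1%:R; have x0 : 0 < x by rewrite ltr0n.
  have x1 : 1 <= x by rewrite ler1n.
  (* The factor [exp c] pays for rounding [N ^ r] down. *)
  have h1 : expR (- (c * (nb_groups r N.+1)%:R)) <= expR c * expR (- (c * x `^ r)).
    rewrite -expRD ler_expR.
    have := ler_wpM2l (ltW c0) (nb_groups_ge r N.+1); rewrite -/x; lra.
  have h2 : expR (- (c * x `^ r)) <= k.+1`!%:R / c ^+ k.+1 / x ^+ 2.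
    rewrite expRN -[leRHS]invrK lef_pV2 ?posrE ?expR_gt0 //; last first.
      by rewrite invr_gt0 !divr_gt0 ?exprn_gt0 // ltr0n fact_gt0.
    have := @expR_ge1Dxn R (c * x `^ r) k.
    rewrite mulr_ge0 ?powR_ge0 ?(ltW c0) // => /(_ isT).
    apply: le_trans; rewrite !invf_div mulrA.
    apply: (@le_trans _ _ ((c * x `^ r) ^+ k.+1 / k.+1`!%:R)); last first.
      by rewrite lerDr.
    rewrite ler_wpM2r ?invr_ge0 // mulrC exprMn ler_wpM2l ?exprn_ge0 ?(ltW c0) //.
    have -> : (x `^ r) ^+ k.+1 = x `^ (r * k.+1%:R).
      by rewrite -powR_mulrn ?powR_ge0 // powRrM.
    rewrite -powR_mulrn ?(ltW x0) //.
    by rewrite ler_powR.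
  have h3 : expR (- (c * (nb_groups r N.+1)%:R)) <= C / x ^+ 2.
    apply: (le_trans h1); rewrite /C -!mulrA ler_wpM2l ?expR_ge0 //.
    by rewrite mulrA.
  have -> : (N.+2%:R * N.+3%:R = (x + 1) * (x + 2) :> R).
    by rewrite /x natr1 -natrD addn2.
  apply: (@le_trans _ _ (C / x ^+ 2 * (6 * x ^+ 2))); last first.
    rewrite mulrCA divfK ?gt_eqF ?exprn_gt0 //.
    by rewrite lerDl.
  apply: ler_pM => //; rewrite ?expR_ge0 ?mulr_ge0 //; try lra.
  have := ler_pM ler01 ler01 x1 x1; rewrite expr2; nra.
have part n : \sum_(0 <= N < n) expR (- (c * (nb_groups r N)%:R)) <= D * (1 - n.+1%:R^-1).
  elim: n => [|n ih]; first by rewrite big_nil invr1 subrr mulr0.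
  rewrite big_nat_recr //=; apply: le_trans (lerD ih (tD n)) _.
  by rewrite -mulrDr addrA subrK.
apply: (@le_lt_trans _ _ D%:E); last exact: ltry.
apply: lime_le; first by apply: is_cvg_nneseries => *; rewrite lee_fin expR_ge0.
apply: nearW => n; rewrite sumEFin lee_fin; apply: le_trans (part n) _.
have D0 : 0 <= D by apply: addr_ge0 => //; exact: mulr_ge0.
by rewrite ler_piMr // gerBl invr_ge0.
Qed.

End summability.

Section borel_cantelli.
Context d (T : measurableType d) (R : realType) (P : probability T R).

Lemma ae_eventually_notin (F : (set T)^nat) (u : nat -> R) :
  (forall k, measurable (F k)) -> (forall k, 0 <= u k) ->
  (\sum_(k <oo) (u k)%:E < +oo)%E ->
  (\forall k \near \oo, (P (F k) <= (u k)%:E)%E) ->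
  {ae P, forall w, \forall k \near \oo, ~ F k w}.
Proof.
move=> mF u0 su [n0 _ Fu].
(* The bound by [u] holds only from [n0] on; emptying the earlier events changes no tail property
   and makes the whole series comparable. *)
pose F' k := if (n0 <= k)%N then F k else set0.
have mF' k : measurable (F' k) by rewrite /F'; case: ifP.
exists (lim_sup_set F'); split.
- by apply: bigcapT_measurable => k; exact: bigcup_measurable.
- apply: lim_sup_set_cvg0 => //; apply: le_lt_trans su.
  apply: lee_nneseries => [k _ //|k _].
  rewrite /F'; case: ifPn => [/Fu //|_]; by rewrite measure0 lee_fin.
- move=> w /= hw n _; apply: contrapT => hn; apply: hw.
  exists (maxn n n0) => // k /=; rewrite geq_max => /andP[nk n0k] Fk.
  by apply: hn; exists k => //; rewrite /F' n0k.
Qed.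

End borel_cantelli.

(** * Independent blocks *)

Section real_probability.
Context d (T : measurableType d) (R : realType) (P : probability T R).
Implicit Types A B : set T.

Definition pr A : R := fine (P A).

Lemma prE A : measurable A -> P A = (pr A)%:E.
Proof. by move=> mA; rewrite fineK // fin_num_measure. Qed.

Lemma pr_ge0 A : 0 <= pr A.
Proof. by rewrite fine_ge0 // measure_ge0. Qed.

Lemma pr_le1 A : measurable A -> pr A <= 1.
Proof. by move=> mA; rewrite -lee_fin -prE // probability_le1. Qed.

Lemma pr_setT : pr setT = 1.
Proof. by rewrite /pr probability_setT. Qed.

Lemma pr_le A B : measurable A -> measurable B -> A `<=` B -> pr A <= pr B.
Proof. by move=> mA mB AB; rewrite -lee_fin -!prE // le_measure ?inE. Qed.

Lemma pr_setD A B : measurable A -> measurable B ->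
  pr (A `\` B) = pr A - pr (A `&` B).
Proof.
move=> mA mB; apply: EFin_inj; rewrite EFinB -!prE //.
- by rewrite measureD // -ge0_fin_numE // fin_num_measure.
- exact: measurableI.
- exact: measurableD.
Qed.

Lemma pr_setC A : measurable A -> pr (~` A) = 1 - pr A.
Proof. by move=> mA; rewrite -setTD pr_setD // pr_setT setTI. Qed.

Lemma pr_bigcup (I : finType) (F : I -> set T) : (forall i, measurable (F i)) ->
  trivIset setT F -> pr (\bigcup_i F i) = \sum_i pr (F i).
Proof.
move=> mF tF; apply: EFin_inj; rewrite -prE; last first.
  by apply: fin_bigcup_measurable => //; exact: finite_finset.
rewrite measure_fin_bigcup //; last exact: finite_finset.
rewrite (fsbig_finite) /=; last exact: finite_finset.
rewrite -sumEFin; under [RHS]eq_bigr do rewrite -prE //.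
apply: perm_big; apply: uniq_perm; rewrite ?finmap.fset_uniq ?index_enum_uniq //.
have fI : finite_set [set: I] by exact: finite_finset.
by move=> i; rewrite mem_index_enum in_fset_set // mem_set.
Qed.

End real_probability.

Section independence.
Context d (Omega : measurableType d) (R : realType) (P : probability Omega R).
Context d' (T : measurableType d') (X : nat -> {RV P >-> T}).
Local Notation pr := (pr P).
Implicit Types (J : seq nat) (A : nat -> set T).

Definition rectangle J A : set Omega := \bigcap_(j in [set` J]) X j @^-1` A j.

Hypothesis indep : forall J A, uniq J -> (forall j, measurable (A j)) ->
  pr (rectangle J A) = \prod_(j <- J) pr (X j @^-1` A j).

Lemma measurable_preimage_RV j (B : set T) : measurable B -> measurable (X j @^-1` B).
Proof. by move=> mB; rewrite -[_ @^-1` _]setTI; exact: measurable_funP. Qed.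

Lemma measurable_rectangle J A : (forall j, measurable (A j)) ->
  measurable (rectangle J A).
Proof.
move=> mA; apply: fin_bigcap_measurable => [|j _]; first exact: finite_seq.
exact: measurable_preimage_RV.
Qed.

(** Two rectangles over disjoint index lists merge into a single one, to which independence, and
    later an induction hypothesis about rectangles, applies. *)
Lemma rectangleI J J' A A' : uniq (J ++ J') ->
  rectangle J A `&` rectangle J' A' =
  rectangle (J ++ J') (fun j => if j \in J then A j else A' j).
Proof.
rewrite cat_uniq => /and3P[_ /hasPn disj _]; apply/seteqP; split => w /=.
  move=> [wA wA'] j /=; rewrite mem_cat; case: ifPn => [jJ _|_ /= jJ']; first exact: wA.
  exact: wA'.
move=> h; split => j /= jJ.
  by have := h j; rewrite /= mem_cat jJ /=; exact.
have := h j; rewrite /= mem_cat jJ orbT => /(_ isT).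
by rewrite (negbTE (disj _ jJ)).
Qed.

Lemma pr_rectangleI J J' A A' : uniq (J ++ J') ->
  (forall j, measurable (A j)) -> (forall j, measurable (A' j)) ->
  pr (rectangle J A `&` rectangle J' A') = pr (rectangle J A) * pr (rectangle J' A').
Proof.
move=> uJ mA mA'; rewrite rectangleI // indep //; last by move=> j; case: ifP.
move: uJ; rewrite cat_uniq => /and3P[uJ /hasPn disj uJ'].
rewrite !indep // big_cat /=; congr (_ * _); rewrite big_seq [RHS]big_seq.
  by apply: eq_bigr => j ->.
by apply: eq_bigr => j jJ'; rewrite (negbTE (disj _ jJ')).
Qed.

(* The events [block_event i] are determined by disjoint blocks [g i] of indices;
   each is a disjoint union of rectangles, which is all the joint independence
   argument uses. *)
Context (I : finType) (g : nat -> seq nat) (V : nat -> I -> nat -> set T).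
Context (p : R) (n : nat).

Definition block_event i : set Omega := \bigcup_(t in [set: I]) rectangle (g i) (V i t).

Definition block_count k w : nat := (\sum_(i < k) (w \in block_event i))%N.

Definition few_block_events k a : set Omega := [set w | (block_count k w < a)%N].

Hypothesis mV : forall i t j, measurable (V i t j).
Hypothesis ug : forall i, (i < n)%N -> uniq (g i).
Hypothesis disjg : forall i i', (i < n)%N -> (i' < n)%N -> i <> i' ->
  forall x, x \in g i -> x \notin g i'.
Hypothesis triv : forall i, (i < n)%N -> trivIset setT (fun t => rectangle (g i) (V i t)).
Hypothesis sum_p : forall i, (i < n)%N -> \sum_t pr (rectangle (g i) (V i t)) = p.

Lemma measurable_block_event i : measurable (block_event i).
Proof.
apply: fin_bigcup_measurable => [|t _]; first exact: finite_finset.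
exact: measurable_rectangle.
Qed.

(** Splitting on the occurrence of the last block event gives the recursion of [binomial_tail]. *)
Lemma few_block_eventsS k a : few_block_events k.+1 a.+1 =
  (few_block_events k a.+1 `\` block_event k) `|` (few_block_events k a `&` block_event k).
Proof.
apply/seteqP; split => w; rewrite /few_block_events /block_count /= big_ord_recr /=.
  have [/set_mem wk|/negP wk] := boolP (w \in block_event k).
    by rewrite addn1 ltnS => h; right.
  by rewrite addn0 => h; left; split => // /mem_set.
move=> [[h wk]|[h wk]]; last by rewrite mem_set // addn1 ltnS.
by rewrite memNset // addn0.
Qed.

Lemma measurable_few_block_events k a : measurable (few_block_events k a).
Proof.
elim: k a => [|k ih] [|a]; try by [rewrite (_ : few_block_events _ _ = set0) //;
  apply/seteqP; split].
  rewrite (_ : few_block_events _ _ = setT) //.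
  by apply/seteqP; split => // w _; rewrite /few_block_events /block_count /= big_ord0.
rewrite few_block_eventsS; apply: measurableU.
  by apply: measurableD => //; exact: measurable_block_event.
by apply: measurableI => //; exact: measurable_block_event.
Qed.

(** The statement with an extra rectangle over fresh indices is what induction on [k] needs: a
    rectangle of block [k] is absorbed into it, and the remaining [k] blocks are still disjoint from
    the enlarged index list. *)
Lemma pr_few_block_eventsI k a J A : (k <= n)%N -> uniq J ->
  (forall j, measurable (A j)) ->
  (forall i, (i < k)%N -> forall x, x \in J -> x \notin g i) ->
  pr (few_block_events k a `&` rectangle J A)
  = binomial_tail p k a * pr (rectangle J A).
Proof.
elim: k a J A => [|k ih] [|a] J A kn uJ mA dJ.
- rewrite (_ : _ `&` _ = set0) ?/pr ?measure0 ?mul0r //.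
  by apply/seteqP; split => // w [].
- rewrite (_ : few_block_events _ _ = setT) ?setTI ?mul1r //.
  by apply/seteqP; split => // w _; rewrite /few_block_events /block_count /= big_ord0.
- rewrite (_ : _ `&` _ = set0) ?/pr ?measure0 ?mul0r //.
  by apply/seteqP; split => // w [].
have mR := measurable_rectangle J mA.
have mC b := measurable_few_block_events k b.
have mE := measurable_block_event k.
have dJk i : (i < k)%N -> forall x, x \in J -> x \notin g i.
  by move=> ik; apply: dJ; exact: ltnW.
have uJk : uniq (g k ++ J).
  rewrite cat_uniq ug // uJ andbT /=; apply/hasPn => x xJ.
  exact: dJ xJ.
(* The occurrence of block event [k] is summed over its disjoint patterns, each merged with
   [rectangle J A]. Its non-occurrence is no union of such rectangles and is obtained below by
   subtraction. *)
have key b : pr (few_block_events k b `&` rectangle J A `&` block_event k)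
    = binomial_tail p k b * p * pr (rectangle J A).
  rewrite /block_event setI_bigcupr pr_bigcup.
  - have -> : binomial_tail p k b * p =
        \sum_t binomial_tail p k b * pr (rectangle (g k) (V k t)).
      by rewrite -mulr_sumr sum_p.
    rewrite mulr_suml; apply: eq_bigr => t _.
    rewrite -setIA [rectangle J A `&` _]setIC rectangleI // ih //.
    + by rewrite -rectangleI // pr_rectangleI // mulrA.
    + exact: ltnW.
    + by move=> j; case: ifP.
    + move=> i ik x; rewrite mem_cat => /orP[xk|]; last exact: dJk.
      apply: (disjg _ _ _ xk) => //; first exact: (ltn_trans ik).
      by move=> ki; rewrite ki ltnn in ik.
  - by move=> t; apply: measurableI; [exact: measurableI|exact: measurable_rectangle].
  - exact: trivIset_setIl (triv kn).
rewrite few_block_eventsS setIUl.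
rewrite (_ : (few_block_events k a.+1 `\` block_event k) `&` rectangle J A =
  (few_block_events k a.+1 `&` rectangle J A) `\` block_event k); last first.
  by rewrite !setDE setIAC.
rewrite setIAC.
have dis : [disjoint few_block_events k a.+1 `&` rectangle J A `\` block_event k
   & few_block_events k a `&` rectangle J A `&` block_event k].
  by apply/disj_setPS => w [[_ h] [_ h']].
have m1 := measurableI _ _ (mC a.+1) mR.
have m2 := measurableI _ _ (mC a) mR.
have -> : forall B C : set Omega, measurable B -> measurable C -> [disjoint B & C] ->
    pr (B `|` C) = pr B + pr C.
- move=> B C mB mC' /disj_setPS BC; apply: EFin_inj; rewrite EFinD -!prE ?measureU //.
  + by rewrite -subset0.
  + exact: measurableU.
- rewrite pr_setD // !key ih //; last exact: ltnW.
  by rewrite /=; ring.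
- exact: measurableD.
- exact: measurableI.
- exact: dis.
Qed.

Lemma pr_few_block_events a : pr (few_block_events n a) = binomial_tail p n a.
Proof.
have := @pr_few_block_eventsI n a [::] (fun=> setT) (leqnn _) isT (fun=> measurableT).
have -> : rectangle [::] (fun=> setT) = setT.
  by apply/seteqP; split => // w _ j.
by rewrite setIT pr_setT mulr1; exact.
Qed.

End independence.

(** * Topology of the sphere *)

Section sphere_topology.
Context {R : realType} {d : nat}.
Local Notation E := 'rV[R]_d.+1.
Local Notation S := (sphere R d).
Implicit Types (s : S).

Lemma enorm_continuous : continuous (@enorm R d.+1).
Proof.
move=> x; apply: (@continuous_comp _ _ _
  (fun x : E => \sum_(i < d.+1) x ord0 i ^+ 2) Num.sqrt); last exact: sqrt_continuous.
move: x; apply: continuous_big => [|i _ x]; first exact: add_continuous.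
have c : {for x, continuous (fun y : E => y ord0 i)} by exact: coord_continuous.
exact: (cvgM c c).
Qed.

Lemma enorm_ge0 (x : E) : 0 <= enorm x.
Proof. exact: sqrtr_ge0. Qed.

Lemma enorm_val s : enorm (val s) = 1.
Proof. exact: (set_mem (valP s)). Qed.

Lemma coord_le_enorm (x : E) i : `|x ord0 i| <= enorm x.
Proof.
rewrite -sqrtr_sqr ler_sqrt ?sumr_ge0 // => [|j _]; last exact: sqr_ge0.
by rewrite (bigD1 i) //= lerDl sumr_ge0 // => j _; exact: sqr_ge0.
Qed.

Lemma val_sphere_continuous : continuous (val : S -> E).
Proof. exact: initial_continuous. Qed.

Lemma coord_sphere_continuous i : continuous (fun s : S => val s ord0 i).
Proof.
move=> s; apply: (@continuous_comp _ _ _ (val : S -> E) (fun x : E => x ord0 i)).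
  exact: val_sphere_continuous.
exact: coord_continuous.
Qed.

(** A filter on the sphere is pushed along [val] into the closed bounded set of unit vectors; the
    cluster point found there is pulled back through the induced topology. *)
Lemma sphere_compact : compact [set: S].
Proof.
move=> F FF _.
have cE : compact [set x : E | enorm x = 1].
  apply: bounded_closed_compact.
    exists 1; split => // M M1 x /= x1; apply: (le_trans _ (ltW M1)).
    rewrite /Num.norm /= mx_normrE; apply/bigmax_leP; split => //= -[i j] _ /=.
    by rewrite (ord1 i) -x1; exact: coord_le_enorm.
  apply: (@preimage_closed _ _ (@enorm R d.+1) [set 1]) => //.
  by move=> ? *; exact: enorm_continuous.
have [] := cE (val @ F) _.
  have h : [set: S] `<=` val @^-1` [set x : E | enorm x = 1].
    by move=> s _; exact: enorm_val.
  exact: (filterS h filterT).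
move=> x [/= x1 cx]; exists (SigSub (mem_set x1) : S); split => // A B FA.
move=> [B' [[B0 oB0 <-] sx sB]].
have [] := cx (val @` A) B0.
- have h : A `<=` val @^-1` (val @` A : set E) by move=> s As; exists s.
  exact: (filterS h FA).
- by apply: open_nbhs_nbhs; split.
- by move=> _ [[s As <-] Bs]; exists s; split => //; exact: sB.
Qed.

(** Heine's theorem, phrased with coordinates because these are what the grid cells control. *)
Lemma sphere_unif_continuous (f : S -> R) (e : R) : continuous f -> 0 < e ->
  exists2 dl : R, 0 < dl & forall s t : S,
    (forall i, `|val s ord0 i - val t ord0 i| < dl) -> `|f s - f t| < e.
Proof.
move=> cf e0; have /compact_near_coveringP cov := sphere_compact.
have [] := cov R (0^'+) (fun dl s => forall t : S,
  (forall i, `|val s ord0 i - val t ord0 i| < dl) -> `|f s - f t| < e) _.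
  move=> s _.
  have e2 : 0 < e / 2 by rewrite divr_gt0.
  have /nbhs_ballP[/= r r0 rB] : nbhs s [set t | `|f s - f t| < e / 2].
    by have /cvgrPdist_lt /(_ _ e2) := cf s.
  have r2 : 0 < r / 2 by rewrite divr_gt0.
  exists (ball s (r / 2), [set x | x < r / 2]).
    split; first exact: nbhsx_ballx.
    exact: nbhs_right_lt.
  move=> [s' dl] /= [ss' dlr] t tdl.
  have -> : f s' - f t = (f s - f t) - (f s - f s') by ring.
  rewrite (le_lt_trans (ler_normB _ _)) // (splitr e) ltrD //; apply: rB.
    apply: (ball_split (z := s')) => //; split => // i j.
    rewrite (ord1 i); exact: lt_trans (tdl j) dlr.
  apply: le_ball ss'; rewrite ler_pdivrMr // ler_peMr ?ler1n //; exact: ltW.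
move=> dl /= dl0 h; exists (dl / 2); first by rewrite divr_gt0.
move=> s; apply: (h (dl / 2)) => //=.
- rewrite sub0r normrN gtr0_norm ?divr_gt0 // ltr_pdivrMr //.
  by rewrite ltr_pMr // ltr1n.
- by rewrite divr_gt0.
Qed.

Lemma open_measurable_borel (T : ptopologicalType) (A : set T) :
  open A -> measurable (A : set (borel T)).
Proof. exact: sub_sigma_algebra. Qed.

Lemma closed_measurable_borel (T : ptopologicalType) (A : set T) :
  closed A -> measurable (A : set (borel T)).
Proof.
by move=> cA; rewrite -[A]setCK; apply: measurableC; apply: open_measurable_borel; exact: closed_openC.
Qed.

Lemma continuous_measurable_borel (T : ptopologicalType) (f : T -> R) :
  continuous f -> measurable_fun setT (f : borel T -> R).
Proof.
move=> /continuousP cf; apply: (measurability _ (RGenOpens.measurableE R)).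
move=> _ [_ [a [b ->] <-]]; rewrite setTI.
by apply: open_measurable_borel; apply: cf; exact: interval_open.
Qed.

(** The origin lies in no cone, even for [t < 0]: its normalisation is [0], which is off the
    sphere. *)
Definition cone (B : set S) (t : R) : set E :=
  [set x | [set val s | s in B] ((enorm x)^-1 *: x) /\ (t < enorm x)%R].

Lemma direction_val (s0 : S) (x : E) s : (enorm x)^-1 *: x = val s ->
  direction s0 x = s.
Proof. by rewrite /direction => ->; rewrite valKd. Qed.

Lemma cone_gt0 (B : set S) t x : cone B t x -> 0 < enorm x.
Proof.
move=> [[s _ sx] _]; rewrite lt_def enorm_ge0 andbT; apply/eqP => x0.
have := enorm_val s; rewrite sx x0 invr0 scale0r /enorm big1 => [|i _].
  by rewrite sqrtr0 => /eqP; rewrite eq_sym oner_eq0.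
by rewrite mxE expr0n.
Qed.

Lemma enormZ (a : R) (x : E) : enorm (a *: x) = `|a| * enorm x.
Proof.
rewrite /enorm -sqrtr_sqr -sqrtrM ?sqr_ge0 //; congr Num.sqrt.
by rewrite mulr_sumr; apply: eq_bigr => i _; rewrite mxE exprMn.
Qed.

Lemma val_direction (s0 : S) (x : E) : enorm x != 0 ->
  val (direction s0 x) = (enorm x)^-1 *: x.
Proof.
move=> x0; rewrite /direction val_insubd mem_set //=.
by rewrite enormZ ger0_norm ?invr_ge0 ?enorm_ge0 // mulVf.
Qed.

Lemma normalize_continuous (x : E) : enorm x != 0 ->
  {for x, continuous (fun y : E => (enorm y)^-1 *: y)}.
Proof.
move=> x0; apply: (@continuousZ _ _ _ (fun y : E => (enorm y)^-1) (fun y : E => y)).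
  by apply: continuousV => //; exact: enorm_continuous.
exact: cvg_id.
Qed.

(** Normalisation is continuous off the origin, so preimages of open sets are open there. At the
    origin the value jumps to [s0], hence the restricted domain. *)
Lemma measurable_direction (s0 : S) :
  measurable_fun ([set x | enorm x != 0] : set (borel E))
    (direction s0 : borel E -> borel S).
Proof.
apply: (@measurability _ _ (borel E) (borel S) _ _ (@open S)) => //.
move=> _ [U oU <-].
apply: open_measurable_borel; case: oU => U' oU' <-.
rewrite openE => x [/= x0 xU]; rewrite /interior.
have xc := normalize_continuous x0.
have n1 : \forall y \near x, enorm y != 0.
  have := enorm_continuous (x := x); move/(_ [set y | y != 0]); apply.
  by apply: open_nbhs_nbhs; split => //; exact: open_neq.
have n2 : \forall y \near x, U' ((enorm y)^-1 *: y).
  apply: xc; apply: open_nbhs_nbhs; split => //.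
  by rewrite -(val_direction s0).
near=> y.
have y0 : enorm y != 0 by near: y; exact: n1.
have yU : U' ((enorm y)^-1 *: y) by near: y; exact: n2.
split => //; rewrite -(val_direction s0 y0) in yU; exact: yU.
Unshelve. all: by end_near. Qed.

Lemma coneE (s0 : S) (B : set S) t :
  cone B t = ([set x | enorm x != 0] `&` direction s0 @^-1` B) `&` [set x | t < enorm x].
Proof.
apply/seteqP; split => x.
  move=> xB; have x0 := cone_gt0 xB; case: xB => -[s Bs sx] tx.
  split => //; split; rewrite /= ?gt_eqF //.
  by rewrite (direction_val s0 (esym sx)).
move=> [[x0 Bx] tx]; split => //; exists (direction s0 x) => //.
by rewrite val_direction.
Qed.

Lemma measurable_cone (B : set (borel S)) t : measurable B ->
  measurable (cone B t : set (borel E)).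
Proof.
move=> mB; rewrite (coneE point); apply: measurableI.
  apply: measurable_direction => //; apply: open_measurable_borel.
  apply: (@open_comp _ _ (@enorm R d.+1) [set y | y != 0]); last exact: open_neq.
  by move=> *; exact: enorm_continuous.
apply: open_measurable_borel.
apply: (@open_comp _ _ (@enorm R d.+1) [set y | t < y]); last exact: open_gt.
by move=> *; exact: enorm_continuous.
Qed.

End sphere_topology.

(** * Partitions of the sphere into continuity sets *)

Section cells.
Context {R : realType} {d : nat}.
Local Notation S := (sphere R d).
Variables (a : R) (k : nat).

Definition cut (z : nat) : R := z%:R / k.+1%:R - a.

(** For [1 <= a <= 2] the cuts indexed here run from [- a <= -1] to beyond [3 - a >= 1], so they
    enclose all coordinates of unit vectors. *)
Definition cell_index := {ffun 'I_d.+1 * 'I_(3 * k.+1).+2 -> bool}.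

Definition cell_code (s : S) : cell_index :=
  [ffun p : 'I_d.+1 * 'I_(3 * k.+1).+2 => val s ord0 p.1 < cut p.2].

Definition cell (c : cell_index) : set S := cell_code @^-1` [set c].

(** The first cut above a coordinate of [u] is at most one mesh width away, and equal codes put the
    same coordinate of [v] below it. Exchanging the two points gives the other inequality. *)
Lemma cell_code_mesh (s t : S) i : 1 <= a <= 2 -> cell_code s = cell_code t ->
  `|val s ord0 i - val t ord0 i| <= k.+1%:R^-1.
Proof.
move=> /andP[a1 a2].
have key (u v : S) : cell_code u = cell_code v ->
    val v ord0 i - val u ord0 i <= k.+1%:R^-1.
  move=> uv; have k0 : 0 < k.+1%:R :> R by rewrite ltr0n.
  have /andP[u1 u2] : -1 <= val u ord0 i <= 1.
    by rewrite -ler_norml; apply: le_trans (coord_le_enorm _ _) _; rewrite enorm_val.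
  (* The coordinate in grid units: the first cut strictly above it has index [(truncn x).+1]. *)
  set x := (val u ord0 i + a) * k.+1%:R.
  have x0 : 0 <= x by rewrite mulr_ge0 //; lra.
  have /andP[zx xz] := truncn_itv x0.
  have hz : ((Num.truncn x).+1 < (3 * k.+1).+2)%N.
    rewrite !ltnS -(ler_nat R) (le_trans zx) // natrM ler_wpM2r //. lra.
  have /ffunP/(_ (i, Ordinal hz)) := uv; rewrite !ffunE /= /cut.
  have -> : val u ord0 i < (Num.truncn x).+1%:R / k.+1%:R - a.
    by rewrite ltrBrDr ltr_pdivlMr.
  move=> /esym h; rewrite lerBlDl; apply: (le_trans (ltW h)).
  rewrite lerBlDr ler_pdivrMr // -(natr1 (Num.truncn x)) mulrDl mulrDl mulVf ?gt_eqF //.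
  by move: zx; rewrite [in leRHS]/x mulrDl -[sval u]/(val u); lra.
move=> st; rewrite ler_norml; have := key _ _ st; have := key _ _ (esym st).
move=> h1 h2; by rewrite h1 andbT lerNl opprB.
Qed.

Lemma measurable_cell c : measurable (cell c : set (borel S)).
Proof.
have -> : cell c = \bigcap_(p in [set: 'I_d.+1 * 'I_(3 * k.+1).+2])
    (if c p then [set s : S | val s ord0 p.1 < cut p.2]
     else [set s : S | cut p.2 <= val s ord0 p.1]).
  apply/seteqP; split => s /=.
    move=> sc p _; have := ffunE (fun p : 'I_d.+1 * 'I_(3 * k.+1).+2 => val s ord0 p.1 < cut p.2) p.
    rewrite -[finfun _]/(cell_code s) sc => ->.
    by case: ifPn => //=; rewrite -leNgt.
  move=> h; apply/ffunP => p; rewrite ffunE; have := h p Logic.I.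
  by case: (c p) => //= ?; apply/negbTE; rewrite -leNgt.
apply: fin_bigcap_measurable => [|p _]; first exact: finite_finset.
case: ifP => _.
  apply: open_measurable_borel.
  apply: (@open_comp _ _ (fun s : S => val s ord0 p.1) [set x | x < cut p.2]); last exact: open_lt.
  by move=> s _; exact: coord_sphere_continuous.
apply: closed_measurable_borel.
apply: (@preimage_closed _ _ (fun s : S => val s ord0 p.1) [set x | cut p.2 <= x]); last exact: closed_ge.
by move=> s _; exact: coord_sphere_continuous.
Qed.

(** Off the cutting hyperplanes the code is locally constant, so such a point is interior either to
    the cell or to its complement. *)
Lemma boundary_cell c : boundary (cell c) `<=`
  \bigcup_(p in [set: 'I_d.+1 * 'I_(3 * k.+1).+2]) [set s : S | val s ord0 p.1 = cut p.2].
Proof.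
move=> s [scl sint]; apply: contrapT => ns.
have nc : nbhs s [set t : S | cell_code t = cell_code s].
  suff : nbhs s [set t : S | forall p : 'I_d.+1 * 'I_(3 * k.+1).+2,
      (val t ord0 p.1 < cut p.2) = (val s ord0 p.1 < cut p.2)].
    by apply: filterS => t h; apply/ffunP => p; rewrite !ffunE.
  apply: (@filter_forall S _ (fun p : 'I_d.+1 * 'I_(3 * k.+1).+2 =>
    [set t : S | (val t ord0 p.1 < cut p.2) = (val s ord0 p.1 < cut p.2)])
    (nbhs s) (nbhs_filter s)) => p.
  have [h|h|h] := ltgtP (val s ord0 p.1) (cut p.2); last by case: ns; exists p.
    have : nbhs s [set t : S | val t ord0 p.1 < cut p.2].
      exact: (@coord_sphere_continuous _ _ p.1 s _ (lt_nbhsl h)).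
    by apply: filterS => t /= ->.
  have : nbhs s [set t : S | cut p.2 < val t ord0 p.1].
    exact: (@coord_sphere_continuous _ _ p.1 s _ (lt_nbhsr h)).
  by apply: filterS => t /= ?; apply/negbTE; rewrite -leNgt ltW.
have [sc|sc] := pselect (cell c s).
  by apply: sint; apply: filterS nc => t; rewrite /cell /= sc.
have [t [tc ts]] := scl _ nc.
by apply: sc; rewrite /cell /= -ts.
Qed.

Lemma bigcup_cell : \bigcup_(c in [set: cell_index]) cell c = [set: S].
Proof. by apply/seteqP; split => // s _; exists (cell_code s). Qed.

Lemma trivIset_cell : trivIset setT cell.
Proof. by move=> c c' _ _ [s [<- <-]]. Qed.

End cells.

Section offsets.
Context {R : realType}.

(** A finite measure has room for only finitely many disjoint sets of mass at least [1 / (n + 1)];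
    the charged sets are the union of these families over [n]. *)
Lemma countable_disjoint_charged d (T : measurableType d)
    (mu : {finite_measure set T -> \bar R}) (I : choiceType) (Z : I -> set T) :
  (forall t, measurable (Z t)) -> trivIset setT Z ->
  countable [set t | mu (Z t) != 0%E].
Proof.
move=> mZ tZ.
have -> : [set t | mu (Z t) != 0%E] =
    \bigcup_(n in [set: nat]) [set t | (n.+1%:R^-1%:E <= mu (Z t))%E].
  apply/seteqP; split => t /=.
    move=> t0; have fZ : mu (Z t) \is a fin_num by exact: fin_num_measure.
    have : 0 < fine (mu (Z t)).
      by rewrite fine_gt0 // lt0e t0 measure_ge0 /= ltey_eq fZ.
    move=> p; exists (Num.truncn (fine (mu (Z t)))^-1) => //=.
    rewrite -[leRHS]fineK // lee_fin invf_ple ?posrE ?ltr0n //.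
    exact/ltW/truncnS_gt.
  move=> [n _ /= h]; apply/eqP => t0; move: h; rewrite t0 lee_fin.
  by rewrite leNgt invr_gt0 ltr0n.
apply: bigcup_countable => // n _; apply: finite_set_countable.
apply: contrapT => inf.
have fT : mu setT \is a fin_num by exact: fin_num_measure.
have [B BA cB] := infinite_set_fset (Num.truncn (n.+1%:R * fine (mu setT))).+1 inf.
have : (mu (\bigcup_(t in [set` B]) Z t) <= mu setT)%E.
  apply: le_measure => //; apply: mem_set => //.
  by apply: fin_bigcup_measurable => //; exact: finite_fset.
rewrite bigcup_fset measure_fbigsetU //; last exact: sub_trivIset tZ.
apply/negP; rewrite -ltNge.
apply: (@lt_le_trans _ _ (\sum_(t <- B) n.+1%:R^-1%:E)%E); last first.
  by rewrite big_seq [leRHS]big_seq; apply: lee_sum => t tB; exact: BA.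
rewrite sumEFin -[ltLHS]fineK // lte_fin big_const_seq count_predT iter_addr_0.
rewrite -[_ *+ _]mulr_natr mulrC ltr_pdivlMr ?ltr0n // mulrC.
by apply: (lt_le_trans (truncnS_gt _)); rewrite ler_nat.
Qed.

(** For fixed [k], [z] and [i], different offsets give disjoint hyperplanes, so only countably many
    offsets give a charged one. Over all triples the bad offsets remain countable, whereas [[1, 2]]
    has positive Lebesgue measure. *)
Lemma exists_offset {d : nat} (sigma : {finite_measure set (borel (sphere R d)) -> \bar R}) :
  exists2 a : R, 1 <= a <= 2 & forall k z (i : 'I_d.+1),
    sigma [set s : sphere R d | val s ord0 i = cut a k z] = 0%E.
Proof.
pose Z (i : 'I_d.+1) (t : R) : set (borel (sphere R d)) :=
  [set s : sphere R d | val s ord0 i = t].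
have mZ i t : measurable (Z i t).
  apply: closed_measurable_borel.
  apply: (@preimage_closed _ _ (fun s : sphere R d => val s ord0 i) [set x | x = t]); last exact: closed_eq.
  by move=> s _; exact: coord_sphere_continuous.
have tZ i : trivIset setT (Z i) by move=> t t' _ _ [s [<- <-]].
pose bad := \bigcup_(q in [set: nat * nat * 'I_d.+1])
  ((fun t => q.1.2%:R / q.1.1.+1%:R - t) @` [set t | sigma (Z q.2 t) != 0%E]).
have cbad : countable bad.
  apply: bigcup_countable => // q _; apply: sub_countable (card_image_le _ _) _.
  exact: countable_disjoint_charged.
have [a [a12 na]] : exists a, `[1, 2]%classic a /\ ~ bad a.
  apply: contrapT => h.
  have sub : `[(1 : R), 2]%classic `<=` bad.
    by move=> x x12; apply: contrapT => nx; apply: h; exists x.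
  have := countable_lebesgue_measure0 (sub_countable (subset_card_le sub) cbad).
  rewrite lebesgue_measure_itv /= lte_fin ltr1n -EFinB => -[] /eqP.
  by rewrite subr_eq0 gt_eqF // ltr1n.
exists a; first by move: a12; rewrite /= in_itv.
move=> k z i; apply: contrapT => h; apply: na; exists (k, z, i) => //=.
exists (cut a k z); first by apply/eqP.
by rewrite /cut opprB addrC subrK.
Qed.

Lemma sigma_boundary_cell {d : nat} (sigma : {finite_measure set (borel (sphere R d)) -> \bar R})
    a k c : (forall z (i : 'I_d.+1),
    sigma [set s : sphere R d | val s ord0 i = cut a k z] = 0%E) ->
  sigma (boundary (@cell R d a k c)) = 0%E.
Proof.
move=> h.
have mZ i t : measurable ([set s : sphere R d | val s ord0 i = t] : set (borel (sphere R d))).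
  apply: closed_measurable_borel.
  apply: (@preimage_closed _ _ (fun s : sphere R d => val s ord0 i) [set x | x = t]); last exact: closed_eq.
  by move=> s _; exact: coord_sphere_continuous.
apply/negligibleP.
  apply: measurableD; first by apply: closed_measurable_borel; exact: closed_closure.
  by apply: open_measurable_borel; exact: open_interior.
pose D := index_enum ('I_d.+1 * 'I_(3 * k.+1).+2)%type.
apply: (@negligibleS _ _ _ _ (\big[setU/set0]_(p <- D)
    ([set s : sphere R d | val s ord0 p.1 = cut a k p.2] : set (borel (sphere R d))))).
  rewrite -bigcup_seq => s /boundary_cell[p _ sp]; exists p => //=.
  by rewrite mem_index_enum.
elim/big_ind: _ => [|A B|p _]; [exact: negligible_set0|exact: negligibleU|].
by apply/negligibleP; [exact: mZ|exact: h].
Qed.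
End offsets.

(** * Weak convergence from convergence on cells *)

Section weak.
Context {R : realType} {d : nat}.
Local Notation S := (sphere R d).
Local Notation BS := (borel S).

Section integral_estimate.
Variables (nu : {measure set BS -> \bar R}) (f : S -> R) (M : R).
Hypothesis nu1 : nu setT = 1%E.
Hypothesis cf : continuous f.
Hypothesis fM : forall x, `|f x| <= M.

Let integrable_on (D : set BS) (g : BS -> R) (M' : R) : measurable D ->
  measurable_fun D g -> (forall x, `|g x| <= M') -> nu.-integrable D (EFin \o g).
Proof.
move=> mD mg gM; apply: measurable_bounded_integrable => //.
  apply: (@le_lt_trans _ _ (nu setT)); first by rewrite le_measure ?inE.
  by rewrite nu1 ltry.
exists M'; split; first exact: num_real.
by move=> M'' MM x _ /=; exact: le_trans (gM x) (ltW MM).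
Qed.

Let fin_nu (D : set BS) : measurable D -> nu D \is a fin_num.
Proof.
move=> mD; rewrite ge0_fin_numE // (@le_lt_trans _ _ (nu setT)) //.
  by rewrite le_measure ?inE.
by rewrite nu1 ltry.
Qed.

Lemma integral_cont_fin : (\int[nu]_x (f x)%:E)%E \is a fin_num.
Proof.
apply: integrable_fin_num => //; apply: (@integrable_on _ f M) => //.
exact: continuous_measurable_borel.
Qed.

(** On each cell [f] is within [e] of the constant [m c], so the integral over it is off by at most
    [e] times its mass; these masses add up to 1. *)
Lemma integral_cell_bounds (I : finType) (B : I -> set BS) (m : I -> R) (e : R) :
  (forall c, measurable (B c)) -> trivIset setT B -> \bigcup_c B c = setT ->
  (forall c s, B c s -> `|f s - m c| <= e) ->
  `|fine (\int[nu]_x (f x)%:E)%E - \sum_c m c * fine (nu (B c))| <= e /\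
  \sum_c fine (nu (B c)) = 1.
Proof.
move=> mB tB cB fm; pose r := index_enum I.
have ur : uniq r by exact: index_enum_uniq.
have trB : trivIset [set` r] B by apply: sub_trivIset tB.
have covE : \big[setU/set0]_(c <- r) B c = setT.
  rewrite -bigcup_seq; apply/seteqP; split => // x _.
  have [c _ Bcx] : (\bigcup_c B c) x by rewrite cB.
  by exists c => //=; rewrite mem_index_enum.
have mf D : measurable D -> measurable_fun D (f : BS -> R).
  move=> mD; exact: measurable_funS (@continuous_measurable_borel _ _ f cf).
have sum1 : \sum_c fine (nu (B c)) = 1.
  apply: EFin_inj; rewrite -sumEFin -nu1 -covE.
  under [LHS]eq_bigr do rewrite fineK ?fin_nu //.
  rewrite -bigcup_seq (measure_fin_bigcup _ (finite_seq r) trB) //.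
  by rewrite -fsbig_seq.
split => //.
have intB c : (\int[nu]_(x in B c) (f x)%:E)%E \is a fin_num.
  by apply: integrable_fin_num => //; apply: (@integrable_on _ f M) => //; exact: mf.
have -> : fine (\int[nu]_x (f x)%:E)%E = \sum_c fine (\int[nu]_(x in B c) (f x)%:E)%E.
  apply: EFin_inj; rewrite fineK ?integral_cont_fin // -sumEFin.
  under [RHS]eq_bigr do rewrite fineK //.
  rewrite -covE integral_bigsetU_EFin // covE; by apply/measurable_EFinP; exact: mf.
have bnd c : `|fine (\int[nu]_(x in B c) (f x)%:E)%E - m c * fine (nu (B c))| <=
    e * fine (nu (B c)).
  have cst_int (x : R) : nu.-integrable (B c) (EFin \o (fun _ : BS => x)).
    by apply: (@integrable_on _ _ `|x|).
  have f_int : nu.-integrable (B c) (EFin \o (f : BS -> R)).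
    by apply: (@integrable_on _ f M) => //; exact: mf.
  have cstE (x : R) : (\int[nu]_(y in B c) (EFin \o (fun _ : BS => x)) y)%E = (x * fine (nu (B c)))%:E.
    by rewrite /= integral_cst // EFinM fineK // fin_nu.
  have up : (\int[nu]_(x in B c) (f x)%:E <= ((m c + e) * fine (nu (B c)))%:E)%E.
    rewrite -cstE; apply: le_integral => // x xB; rewrite lee_fin.
    by have := fm c x (set_mem xB); rewrite ler_norml => /andP[_]; lra.
  have lo : (((m c - e) * fine (nu (B c)))%:E <= \int[nu]_(x in B c) (f x)%:E)%E.
    rewrite -cstE; apply: le_integral => // x xB; rewrite lee_fin.
    by have := fm c x (set_mem xB); rewrite ler_norml => /andP[]; lra.
  move: up lo; rewrite -(fineK (intB c)) !lee_fin /= => up lo.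
  by rewrite ler_norml; apply/andP; split; lra.
rewrite -sumrB; apply: (le_trans (ler_norm_sum _ _ _)).
apply: (@le_trans _ _ (\sum_c e * fine (nu (B c)))); first exact: ler_sum.
by rewrite -mulr_sumr sum1 mulr1.
Qed.

End integral_estimate.

(* One-sided bounds suffice: the cells form a finite partition and all masses are
   eventually 1, so no cell can gain mass without another one losing it. *)
Lemma weak_cvg_of_cells (mu_ : nat -> {measure set BS -> \bar R})
    (mu : {measure set BS -> \bar R}) (a : R) :
  1 <= a <= 2 -> mu setT = 1%E ->
  (\forall N \near \oo, mu_ N setT = 1%E) ->
  (forall k c (eta : R), 0 < eta ->
    \forall N \near \oo, fine (mu (@cell R d a k c)) - eta <= fine (mu_ N (cell a c))) ->
  weak_cvg mu_ mu.
Proof.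
move=> a12 mu1 muN1 h f cf [M0 fM0].
pose M := `|M0| + 1; have M_gt0 : 0 < M by rewrite ltr_wpDl.
have fM x : `|f x| <= M.
  by rewrite (le_trans (fM0 x)) // (le_trans (ler_norm _)) // lerDl.
rewrite -(fineK (integral_cont_fin mu1 cf fM)); apply/fine_cvgP; split.
  by apply: filterS muN1 => N N1; exact: (integral_cont_fin N1 cf fM).
apply/cvgrPdist_le => e e0.
have e3 : 0 < e / 3 by rewrite divr_gt0.
have [dl dl0 unif] := sphere_unif_continuous cf e3.
pose k := Num.truncn dl^-1.
have kdl : k.+1%:R^-1 < dl.
  by rewrite invf_plt ?posrE // ?ltr0n // truncnS_gt.
(* The value of [f] at a chosen point of the cell. For an empty cell the point is arbitrary, and
   only the bound [M] is used of it. *)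
pose m c := f (get (@cell R d a k c)).
have fm c s : cell a c s -> `|f s - m c| <= e / 3.
  move=> cs; apply/ltW/unif => i; apply: le_lt_trans kdl.
  apply: cell_code_mesh => //; first exact: a12.
  have gc := @getPex _ (@cell R d a k c) (ex_intro _ s cs).
  exact: (etrans cs (esym gc)).
pose n : R := \sum_(c : cell_index (d:=d) k) 1.
have n0 : 0 <= n by apply: sumr_ge0.
(* Chosen so that an error [2 * M * eta] in each of the [n] cells totals at most [e / 3]; the [+ 1]
   keeps the denominator positive. *)
pose eta := e / 3 / (2 * M * n + 1).
have den : 0 < 2 * M * n + 1 by rewrite ltr_wpDl // mulr_ge0 // mulr_ge0 // ltW.
have eta0 : 0 < eta by rewrite divr_gt0.
have hall : \forall N \near \oo, forall c : cell_index k,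
    fine (mu (@cell R d a k c)) - eta <= fine (mu_ N (cell a c)).
  apply: filter_forall => c; exact: h.
apply: filterS2 hall muN1 => N hN N1.
have mc c := @measurable_cell R d a k c.
have tc := @trivIset_cell R d a k.
have cc := @bigcup_cell R d a k.
have [b1 s1] := integral_cell_bounds mu1 cf fM mc tc cc fm.
have [b2 s2] := integral_cell_bounds N1 cf fM mc tc cc fm.
set I1 := fine _ in b1 *; set I2 := fine _ in b2 *.
set A := \sum_c _ in b1; set A' := \sum_c _ in b2.
have AA : `|A - A'| <= e / 3.
  have eta_n : \sum_(c : cell_index (d:=d) k) 2 * M * eta <= e / 3.
    have -> : \sum_(c : cell_index (d:=d) k) 2 * M * eta = 2 * M * eta * n.
      by rewrite /n mulr_sumr; apply: eq_bigr => c _; rewrite mulr1.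
    have -> : 2 * M * eta * n = e / 3 * ((2 * M * n) / (2 * M * n + 1)).
      by rewrite /eta; ring.
    by rewrite ler_piMr ?(ltW e3) // ler_pdivrMr // mul1r lerDl.
  have mM c : - M <= m c <= M by rewrite -ler_norml; exact: fM.
  pose D c := fine (mu_ N (@cell R d a k c)) - fine (mu (@cell R d a k c)).
  have Dge c : - eta <= D c by have := hN c; rewrite /D; lra.
  have D0 : \sum_c D c = 0 by rewrite sumrB s1 s2 subrr.
  have A'A : A' - A = \sum_c m c * D c.
    by rewrite -sumrB; apply: eq_bigr => c _; rewrite -mulrBr.
  (* As the [D c] sum to 0, every [m c] may be lowered by [M] (raised by [M] for the other side).
     The coefficients then have constant sign and size at most [2 * M], so the one-sided bound
     [- eta <= D c] suffices. *)
  have up : A' - A <= e / 3.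
    apply: le_trans eta_n.
    have -> : A' - A = \sum_c (m c - M) * D c.
      rewrite A'A; under [RHS]eq_bigr do rewrite mulrBl.
      by rewrite sumrB -mulr_sumr D0 mulr0 subr0.
    apply: ler_sum => c _; have := Dge c; have /andP[] := mM c; nra.
  have lo : - (e / 3) <= A' - A.
    rewrite lerNl; apply: le_trans eta_n.
    have -> : - (A' - A) = \sum_c - ((m c + M) * D c).
      rewrite A'A sumrN; congr (- _); under [RHS]eq_bigr do rewrite mulrDl.
      by rewrite big_split /= -mulr_sumr D0 mulr0 addr0.
    apply: ler_sum => c _; have := Dge c; have /andP[] := mM c; nra.
  by rewrite distrC ler_norml lo up.
have I12 : `|I1 - I2| <= e.
  move: b1 b2 AA; rewrite !ler_norml => /andP[? ?] /andP[? ?] /andP[? ?].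
  by apply/andP; split; lra.
exact: I12.
Qed.

End weak.

(** * The direction of the largest vector *)

Section regular_variation.
Context {R : realType} {d : nat}.
Local Notation E := 'rV[R]_d.+1.
Local Notation S := (sphere R d).

Lemma cone_setT (x : E) t : 0 < enorm x -> t < enorm x -> cone setT t x.
Proof.
move=> x0 tx; split => //; exists (direction point x) => //.
by rewrite val_direction // gt_eqF.
Qed.

Lemma cone_setI_setT (B : set S) (t t' : R) : cone B t `&` cone setT t' `<=` cone B t'.
Proof. by move=> x [[sx _] [_ tx]]. Qed.

Context (disp : measure_display) (Omega : measurableType disp).
Context (P : probability Omega R) (xi : {RV P >-> borel E}).
Context (alpha : R) (sigma : {finite_measure set (borel S) -> \bar R}).
Hypothesis alpha0 : 0 < alpha.
Hypothesis sigma0 : sigma setT <> 0%E.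
Hypothesis rv : regularly_varying xi alpha sigma.

Local Notation q B t := (pr P (xi @^-1` cone B t)).
Let c : R := fine (sigma setT).

Let fin_sigma (B : set (borel S)) : measurable B -> sigma B \is a fin_num.
Proof. by move=> mB; exact: fin_num_measure. Qed.

Lemma sigma_setT_gt0 : 0 < c.
Proof.
rewrite fine_gt0 // lt0e measure_ge0 /= andbT ltey_eq fin_sigma // andbT.
exact/eqP.
Qed.
Let c0 := sigma_setT_gt0.

Let mcone (B : set (borel S)) t : measurable B -> measurable (xi @^-1` cone B t).
Proof.
move=> mB; rewrite -[_ @^-1` _]setTI; apply: measurable_funP => //.
exact: measurable_cone.
Qed.

Lemma regularly_varying_pr : exists b : nat -> R, forall rho (B : set (borel S)),
  0 < rho -> measurable B -> sigma (boundary (B : set S)) = 0%E ->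
  (n%:R * q B (rho * b n)) @[n --> \oo] --> fine (sigma B) * rho `^ (- alpha).
Proof.
case: rv => L _ h; exists (fun n => n%:R `^ alpha^-1 * L n%:R) => rho B rho0 mB sB.
have := h rho B rho0 mB sB.
have -> : (sigma B * (rho `^ (- alpha))%:E)%E = (fine (sigma B) * rho `^ (- alpha))%:E.
  by rewrite EFinM fineK ?fin_sigma.
move=> /fine_cvgP[_].
apply: cvg_trans; apply: near_eq_cvg; apply: nearW => n /=.
by rewrite (prE P (mcone _ mB)).
Qed.

Lemma boundary_setT : boundary (@setT S) = set0.
Proof. by rewrite /boundary interiorT setDT. Qed.

(** Term [j] of the sum is the probability that, among [m] independent copies, one lies in [D m j]
    and all others in [Q m j]. The first four clauses make these events disjoint and put the
    direction of the largest vector in [B]. The number [K] of slices does not depend on [m]. *)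
Lemma max_direction_lower_bound (B : set (borel S)) (e : R) : measurable B ->
  sigma (boundary (B : set S)) = 0%E -> 0 < e ->
  exists K (D Q : nat -> 'I_K -> set (borel E)),
  [/\ forall m j, measurable (D m j) /\ measurable (Q m j),
      forall m j x y, D m j x -> Q m j y -> enorm y < enorm x,
      forall m j x (s0 : S), D m j x -> B (direction s0 x),
      forall m, trivIset setT (D m) &
      \forall m \near \oo, fine (sigma B) / c - e <=
        \sum_(j < K) m%:R * (pr P (xi @^-1` D m j) * pr P (xi @^-1` Q m j) ^+ m.-1) ].
Proof.
move=> mB sB e0; have [b bP] := regularly_varying_pr.
have e2 : 0 < e / 2 by rewrite divr_gt0.
have [h [h0 [K hK]]] := exp_riemann_sum_ge e2.
(* [rho j] is chosen so that the mean number of the [m] vectors of norm above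
   [rho j * b m] tends to [u_j = j.+1 * h].  A vector in [D m j] then beats a group
   whose other members lie in [Q m j]; the corresponding probabilities tend to the
   terms of a lower Riemann sum of [sigma(B)/c * \int exp(-u) du].  Nothing is assumed
   on the sign of [b m]: if [b m <= 0] the sets [D m j] are merely empty. *)
pose rho j : R := (j.+1%:R * h / c) `^ (- alpha^-1).
have arg0 j : 0 < j.+1%:R * h / c by rewrite divr_gt0 // mulr_gt0 // ltr0n.
have rho0 j : 0 < rho j by rewrite powR_gt0.
have rhoE j : rho j `^ (- alpha) = j.+1%:R * h / c.
  by rewrite /rho -powRrM mulrNN mulVf ?gt_eqF // powRr1 // ltW.
have rho_le i j : (i <= j)%N -> rho j <= rho i.
  move=> ij; rewrite /rho !powRN lef_pV2 ?posrE ?powR_gt0 //.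
  apply: ge0_ler_powR; rewrite ?nnegrE ?invr_ge0 ?(ltW alpha0) ?(ltW (arg0 _)) //.
  by rewrite ler_wpM2r ?invr_ge0 ?(ltW c0) // ler_wpM2r ?(ltW h0) // ler_nat ltnS.
pose D m (j : 'I_K) : set (borel E) := cone B (rho j.+1 * b m) `\` cone setT (rho j * b m).
pose Q m (j : 'I_K) : set (borel E) := ~` cone setT (rho j.+1 * b m).
exists K, D, Q; split.
- move=> m j; split; first by apply: measurableD; exact: measurable_cone.
  by apply: measurableC; exact: measurable_cone.
- move=> m j x y [xB _] yQ; have x0 := cone_gt0 xB.
  rewrite ltNge; apply/negP => xy; apply: yQ; apply: cone_setT.
    exact: lt_le_trans xy.
  by apply: lt_le_trans xy; case: xB.
- by move=> m j x s0 [[[s Bs /esym sx] _] _]; rewrite (direction_val s0 sx).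
- move=> m i j _ _ [x [[xi1 nxi] [xj nxj]]].
  have x0 := cone_gt0 xi1.
  have le_rho k : ~ cone setT (rho k * b m) x -> enorm x <= rho k * b m.
    by move=> nk; rewrite leNgt; apply/negP => tx; apply: nk; exact: cone_setT.
  have hi := le_rho _ nxi; have hj := le_rho _ nxj.
  (* A common point has positive norm at most [rho i * b m], which forces [b m > 0]; the levels are
     then ordered and the slices lie in disjoint shells. *)
  have b0 : 0 < b m by rewrite -(pmulr_rgt0 _ (rho0 i)); exact: lt_le_trans hi.
  have key u v : (u < v)%N -> enorm x <= rho v * b m -> rho u.+1 * b m < enorm x -> False.
    move=> uv h1 h2; have := lt_le_trans h2 h1; rewrite ltNge => /negP; apply.
    by rewrite ler_pM2r //; exact: rho_le.
  apply: val_inj; case: (ltngtP i j) => // ij; exfalso.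
    by apply: (key _ _ ij hj); case: xi1.
  by apply: (key _ _ ij hi); case: xj.
have sT : sigma (boundary (setT : set S)) = 0%E by rewrite boundary_setT measure0.
have cvgS (j : nat) : (m%:R * q setT (rho j * b m)) @[m --> \oo] --> j.+1%:R * h.
  have := bP _ setT (rho0 j) measurableT sT.
  by rewrite rhoE -/c mulrCA mulfV ?gt_eqF // mulr1.
have cvgq (j : nat) : q setT (rho j * b m) @[m --> \oo] --> (0 : R).
  have : (m%:R^-1 * (m%:R * q setT (rho j * b m))) @[m --> \oo] --> 0 * (j.+1%:R * h).
    apply: cvgM (cvgS j); rewrite -(cvg_shiftS (fun m : nat => m%:R^-1 : R)).
    exact: cvg_harmonic.
  rewrite mul0r; apply: cvg_trans; apply: near_eq_cvg; near=> m.
  by rewrite mulrA mulVf ?mul1r // pnatr_eq0 -lt0n; near: m; exact: nbhs_infty_gt.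
(* A lower bound made only of quantities with known limits: [P(D)] is bounded below by a difference
   of cone probabilities, [P(Q) ^ m.-1] by [one_minus_exp_ge]. *)
pose v m := \sum_(j < K) (m%:R * q B (rho j.+1 * b m) - m%:R * q B (rho j * b m)) *
  expR (- (m%:R * q setT (rho j.+1 * b m) / (1 - q setT (rho j.+1 * b m)))).
have cvgv : v m @[m --> \oo] --> \sum_(j < K) (fine (sigma B) / c * h) * expR (- (j.+2%:R * h)).
  apply: cvg_big => [|j _]; first exact: add_continuous.
  apply: cvgM.
    have -> : fine (sigma B) / c * h =
        fine (sigma B) * (j.+2%:R * h / c) - fine (sigma B) * (j.+1%:R * h / c).
      by rewrite -[j.+2%:R]natr1; ring.
    by rewrite -!rhoE; apply: cvgB; exact: bP.
  apply: continuous_cvg; first exact: continuous_expR.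
  apply: cvgN; rewrite -[X in _ --> X]divr1; apply: cvgM; first exact: cvgS.
  apply: cvgV; first exact: oner_neq0.
  by rewrite -[X in _ --> X]subr0; apply: cvgB; [exact: cvg_cst|exact: cvgq].
have sB1 : 0 <= fine (sigma B) / c <= 1.
  rewrite divr_ge0 ?fine_ge0 ?(ltW c0) //= ler_pdivrMr // mul1r fine_le ?fin_sigma //.
  by rewrite le_measure ?inE.
(* The Riemann sum loses at most [e / 2], and [sigma(B) / c <= 1]; the other [e / 2] makes the
   inequality strict, so that it passes to large [m]. *)
have limv : fine (sigma B) / c - e < \sum_(j < K) (fine (sigma B) / c * h) * expR (- (j.+2%:R * h)).
  under eq_bigr do rewrite -mulrA.
  rewrite -mulr_sumr; case/andP: sB1 => s0 s1.
  have := ler_wpM2l s0 hK; rewrite mulrBr mulr1.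
  have : fine (sigma B) / c * (e / 2) <= e / 2 by rewrite ler_piMl // ltW.
  lra.
have q1 : \forall m \near \oo, forall j : 'I_K, q setT (rho j.+1 * b m) < 1.
  apply: filter_forall => j; exact: (cvgr_lt _ (cvgq j.+1) _ ltr01).
near=> m.
have vm : fine (sigma B) / c - e <= v m.
  by apply/ltW; near: m; exact: (cvgr_gt _ cvgv _ limv).
apply: (le_trans vm); apply: ler_sum => j _.
have q1m : q setT (rho j.+1 * b m) < 1 by move: j; near: m.
have mD t : measurable (xi @^-1` cone B t) by exact: mcone.
have mS t : measurable (xi @^-1` cone setT t) by exact: mcone.
have prQ : pr P (xi @^-1` Q m j) = 1 - q setT (rho j.+1 * b m).
  by rewrite /Q -preimage_setC pr_setC.
have prD : q B (rho j.+1 * b m) - q B (rho j * b m) <= pr P (xi @^-1` D m j).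
  rewrite (_ : xi @^-1` D m j = xi @^-1` cone B (rho j.+1 * b m) `\`
    xi @^-1` cone setT (rho j * b m)) // pr_setD // lerD2l lerN2; apply: pr_le => //.
    exact: measurableI.
  by move=> w /=; exact: cone_setI_setT.
have Q01 : 0 <= pr P (xi @^-1` Q m j) <= 1.
  by rewrite pr_ge0 prQ gerBl pr_ge0.
have expQ : expR (- (m%:R * q setT (rho j.+1 * b m) / (1 - q setT (rho j.+1 * b m)))) <=
    pr P (xi @^-1` Q m j) ^+ m.-1.
  apply: (@le_trans _ _ (pr P (xi @^-1` Q m j) ^+ m)).
    by rewrite prQ; apply: one_minus_exp_ge; rewrite pr_ge0.
  by apply: ler_wiXn2l; case/andP: Q01 => //; rewrite leq_pred.
(* Treating [y < 0] separately, where the left-hand side is nonpositive, avoids discussing the sign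
   of [b m]. *)
rewrite mulrA -mulrBr; set y := q B _ - q B _ in prD *.
have [y0|y0] := leP 0 y.
  by apply: ler_pM => //; rewrite ?mulr_ge0 ?expR_ge0 // ler_wpM2l.
apply: (@le_trans _ _ 0).
  by rewrite mulr_le0_ge0 ?expR_ge0 // mulr_ge0_le0 // ltW.
by rewrite !mulr_ge0 ?exprn_ge0 ?pr_ge0.
Unshelve. all: by end_near. Qed.

End regular_variation.

(** * Empirical measures *)

Section group_sizes.
Context {R : realType}.

Lemma nb_groups_gt0 (r : R) N : 0 < r -> (0 < N)%N -> (0 < nb_groups r N)%N.
Proof.
move=> r0 N0; rewrite truncn_gt0.
have : (1 : R) `^ r <= N%:R `^ r.
  by apply: ge0_ler_powR; rewrite ?nnegrE ?(ltW r0) // ler1n.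
by rewrite powR1.
Qed.

(** There are at most [N ^ r] groups, so [M] vectors fit in each once [M <= N ^ (1 - r)]. *)
Lemma group_size_large (r : R) (M : nat) : 0 < r -> r < 1 ->
  \forall N \near \oo, (M <= group_size r N)%N.
Proof.
move=> r0 r1; have r1' : 0 < 1 - r by rewrite subr_gt0.
near=> N.
have N0 : (0 < N)%N by near: N; exact: nbhs_infty_gt.
rewrite /group_size leq_divRL ?nb_groups_gt0 // -(ler_nat R) natrM.
have nN : (nb_groups r N)%:R <= N%:R `^ r :> R.
  by case/andP: (truncn_itv (powR_ge0 (N%:R : R) r)).
have -> : (N%:R : R) = N%:R `^ (1 - r) * N%:R `^ r.
  rewrite -powRD ?subrK ?powRr1 //.
  by apply/implyP => _; rewrite pnatr_eq0 -lt0n.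
apply: ler_pM => //.
have MN : (M%:R : R) `^ (1 - r)^-1 <= N%:R by near: N; exact: nbhs_infty_ger.
have -> : (M%:R : R) = (M%:R `^ (1 - r)^-1) `^ (1 - r).
  by rewrite -powRrM mulVf ?gt_eqF // powRr1.
by apply: ge0_ler_powR; rewrite ?nnegrE ?powR_ge0 ?(ltW r1').
Unshelve. all: by end_near. Qed.

End group_sizes.

(** A strict maximiser leaves no tie to break, so [pick] can return nothing else. *)
Lemma group_max_strict (R : realType) (N d : nat) (x : nat -> 'rV[R]_d)
    (A : {set 'I_N}) (o : 'I_N) : o \in A ->
  (forall k : 'I_N, k \in A -> k != o -> enorm (x k) < enorm (x o)) ->
  group_max x A = x o.
Proof.
move=> oA omax; rewrite /group_max /max_index; case: pickP => [j /andP[jA]|].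
  move=> /forallP/(_ o)/implyP/(_ oA); have [->//|jo] := eqVneq j o.
  have := omax j jA jo => /[dup] /lt_gtF -> /gt_eqF.
  by rewrite eq_sym => /= ->.
move=> /(_ o); rewrite oA /= => /negbT/negP[]; apply/forallP => k.
apply/implyP => kA; have [->|ko] := eqVneq k o; first by rewrite eqxx leqnn orbT.
by rewrite omax.
Qed.

Section sigma_hat.
Context {R : realType} {d : nat}.
Variables (s0 : sphere R d) (r : R) (N : nat) (G : nat -> {set 'I_N}).
Variable x : nat -> 'rV[R]_d.+1.

Lemma sigma_hatE (B : set (borel (sphere R d))) :
  fine (sigma_hat s0 r G x B) =
  (nb_groups r N)%:R^-1 *
  \sum_(i < nb_groups r N) ((direction s0 (group_max x (G i)) \in B)%:R : R).
Proof.
rewrite /sigma_hat /= /mscale /= /msum /=.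
under eq_bigr do rewrite diracE.
by rewrite sumEFin.
Qed.

Lemma sigma_hat_setT : (0 < nb_groups r N)%N -> sigma_hat s0 r G x setT = 1%E.
Proof.
move=> n0; rewrite /sigma_hat /= /mscale /= /msum /=.
under eq_bigr do rewrite diracE in_setT.
rewrite sumEFin -EFinM sumr_const card_ord mulVf //.
by rewrite pnatr_eq0 -lt0n.
Qed.

End sigma_hat.

Section empirical_lower_bound.
Context (R : realType) (d : nat) (alpha : R)
  (sigma : {finite_measure set (borel (sphere R d)) -> \bar R})
  (disp : measure_display) (Omega : measurableType disp)
  (P : probability Omega R)
  (xi : {RV P >-> borel 'rV[R]_d.+1})
  (xi_ : nat -> {RV P >-> borel 'rV[R]_d.+1})
  (r : R) (s0 : sphere R d)
  (G : forall N : nat, nat -> {set 'I_N}).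
Hypothesis alpha0 : 0 < alpha.
Hypothesis sigma0 : sigma [set: borel (sphere R d)] <> 0%E.
Hypothesis indep : mutually_independent xi_.
Hypothesis ident : forall j : nat, identically_distributed (xi_ j) xi.
Hypothesis rv : regularly_varying xi alpha sigma.
Hypothesis r0 : 0 < r.
Hypothesis r1 : r < 1.
Hypothesis grouping : forall N : nat,
  is_grouping (nb_groups r N) (group_size r N) (G N).
Local Notation E := 'rV[R]_d.+1.

Lemma pr_rectangle (J : seq nat) (A : nat -> set (borel E)) :
  uniq J -> (forall j, measurable (A j)) ->
  pr P (rectangle xi_ J A) = \prod_(j <- J) pr P (xi_ j @^-1` A j).
Proof.
move=> uJ mA; apply: EFin_inj.
rewrite -prE; last exact: measurable_rectangle.
rewrite /rectangle indep // -prodEFin; apply: eq_bigr => j _.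
by rewrite prE //; exact: measurable_preimage_RV.
Qed.

Definition group_seq N i : seq nat := [seq val k | k <- enum (G N i)].

Lemma group_seq_uniq N i : uniq (group_seq N i).
Proof. by rewrite map_inj_uniq ?enum_uniq //; exact: val_inj. Qed.

Lemma size_group_seq N i : (i < nb_groups r N)%N ->
  size (group_seq N i) = group_size r N.
Proof. by move=> iN; rewrite size_map -cardE; case: (grouping N) => + _; apply. Qed.

Lemma group_seq_disjoint N i j : (i < nb_groups r N)%N -> (j < nb_groups r N)%N ->
  i <> j -> forall x, x \in group_seq N i -> x \notin group_seq N j.
Proof.
move=> iN jN ij x /mapP[k]; rewrite mem_enum => ki ->.
rewrite mem_map; last exact: val_inj.
by rewrite mem_enum; have := (grouping N).2 i j iN jN ij => /disjointFr ->.
Qed.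

(** The pattern [t] consists of the position of the winner in the list [g] and of its slice. Using a
    position instead of a sample index lets all groups of size [m] share one finite type of
    patterns. *)
Definition winner_pattern m K (D Q : 'I_K -> set (borel E)) (g : seq nat)
    (t : 'I_m * 'I_K) (k : nat) : set (borel E) :=
  if k == nth 0%N g t.1 then D t.2 else Q t.2.

Lemma pr_winner_rectangle m K (D Q : 'I_K -> set (borel E)) (g : seq nat)
    (t : 'I_m * 'I_K) : (forall j, measurable (D j)) -> (forall j, measurable (Q j)) ->
  uniq g -> size g = m ->
  pr P (rectangle xi_ g (winner_pattern D Q g t)) =
  pr P (xi @^-1` D t.2) * pr P (xi @^-1` Q t.2) ^+ m.-1.
Proof.
move=> mD mQ ug sg; rewrite pr_rectangle //; last first.
  by move=> j; rewrite /winner_pattern; case: ifP.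
have kg : nth 0%N g t.1 \in g by rewrite mem_nth // sg.
rewrite (bigD1_seq _ kg ug) /=; congr (_ * _).
  by rewrite /winner_pattern eqxx /pr ident.
under eq_bigr => k kn do rewrite /winner_pattern (negbTE kn) /pr ident //.
rewrite big_const_seq iter_mulr_1; congr (_ ^+ _).
have := count_predC (pred1 (nth 0%N g t.1)) g.
by rewrite count_uniq_mem // kg sg add1n => /(congr1 predn).
Qed.

(** Two different winners would each be strictly longer than the other; for a common winner the
    slices are disjoint. *)
Lemma trivIset_winner m K (D Q : 'I_K -> set (borel E)) (g : seq nat) :
  (forall j x y, D j x -> Q j y -> enorm y < enorm x) -> trivIset setT D ->
  uniq g -> size g = m ->
  trivIset setT (fun t : 'I_m * 'I_K => rectangle xi_ g (winner_pattern D Q g t)).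
Proof.
move=> DQ tD ug sg [l j] [l' j'] _ _ [w [wt wt']].
have lg (k : 'I_m) : nth 0%N g k \in g by rewrite mem_nth // sg.
have [ll|ll] := eqVneq (l : nat) l'.
  have := wt _ (lg l); have := wt' _ (lg l); rewrite /= /winner_pattern /= ll eqxx.
  move=> h' h; congr pair; first exact: val_inj.
  by apply: tD => //; exists (xi_ (nth 0%N g l') w).
have nl : (nth 0%N g l == nth 0%N g l') = false.
  by rewrite nth_uniq ?sg //; exact/negbTE.
have := wt _ (lg l); have := wt _ (lg l').
have := wt' _ (lg l); have := wt' _ (lg l').
rewrite /= /winner_pattern /= !eqxx nl eq_sym nl => h1 h2 h3 h4.
by have := lt_trans (DQ _ _ _ h1 h2) (DQ _ _ _ h4 h3); rewrite ltxx.
Qed.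

Lemma winner_direction N i m K (D Q : 'I_K -> set (borel E))
    (B : set (sphere R d)) (t : 'I_m * 'I_K) w :
  (forall j x y, D j x -> Q j y -> enorm y < enorm x) ->
  (forall j x, D j x -> B (direction s0 x)) ->
  size (group_seq N i) = m ->
  rectangle xi_ (group_seq N i) (winner_pattern D Q (group_seq N i) t) w ->
  B (direction s0 (group_max (fun j => xi_ j w : E) (G N i))).
Proof.
move=> DQ DB sg wt; set g := group_seq N i in sg wt.
have kg : nth 0%N g t.1 \in g by rewrite mem_nth // sg.
have /mapP[z] := kg; rewrite mem_enum => zG ko.
have := wt _ kg; rewrite /= /winner_pattern eqxx ko => xoD.
rewrite (@group_max_strict _ _ _ _ _ z) //; first exact: DB xoD.
move=> k kG kn; apply: (DQ _ _ _ xoD).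
have kg' : val k \in g by apply/mapP; exists k => //; rewrite mem_enum.
have := wt _ kg'; rewrite /= /winner_pattern ko.
by rewrite (inj_eq val_inj) (negbTE kn).
Qed.

(** Half of [e] is spent on the probability of a block event in one group, the other half is the gap
    in Chernoff's bound. *)
Lemma sigma_hat_lower_bound (B : set (borel (sphere R d))) (e : R) :
  measurable B -> sigma (boundary (B : set (sphere R d))) = 0%E -> 0 < e ->
  {ae P, forall w, \forall N \near \oo,
    fine (sigma B) / fine (sigma setT) - e <=
    fine (sigma_hat s0 r (G N) (fun j => xi_ j w : E) B)}.
Proof.
move=> mB sB e0; set q := _ - e.
(* Chernoff's bound is stated for a nonnegative threshold; below 0 the claim is trivial. *)
have [q0|q0] := ltP q 0.
  apply: aeW => w; apply: nearW => N; apply: (le_trans (ltW q0)).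
  exact: fine_ge0.
have e2 : 0 < e / 2 by rewrite divr_gt0.
have [K [D [Q [mDQ DQ DB tD lowp]]]] :=
  max_direction_lower_bound alpha0 sigma0 rv mB sB e2.
pose m N := group_size r N; pose n N := nb_groups r N.
pose V N i : 'I_(m N) * 'I_K -> nat -> set (borel E) :=
  winner_pattern (D (m N)) (Q (m N)) (group_seq N i).
pose p N := \sum_(j < K) (m N)%:R *
  (pr P (xi @^-1` D (m N) j) * pr P (xi @^-1` Q (m N) j) ^+ (m N).-1).
(* The successor makes the strict count inequality mean at most [n * q] block events, so off [F N]
   their number exceeds [n * q]. *)
pose F N := few_block_events xi_ (group_seq N) (V N) (n N) (Num.truncn ((n N)%:R * q)).+1.
have mV N i t j : measurable (V N i t j).
  by rewrite /V /winner_pattern; case: ifP => _; case: (mDQ (m N) t.2).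
have tV N i : (i < n N)%N ->
    trivIset setT (fun t => rectangle xi_ (group_seq N i) (V N i t)).
  move=> iN; apply: trivIset_winner => //; first exact: DQ.
  - exact: group_seq_uniq.
  - exact: size_group_seq.
have sV N i : (i < n N)%N ->
    \sum_t pr P (rectangle xi_ (group_seq N i) (V N i t)) = p N.
  move=> iN; under eq_bigr => t _.
    rewrite /V pr_winner_rectangle //; last 4 first.
    + by move=> j; case: (mDQ (m N) j).
    + by move=> j; case: (mDQ (m N) j).
    + exact: group_seq_uniq.
    + exact: size_group_seq.
    over.
  rewrite -(pair_bigA _ (fun (l : 'I_(m N)) (j : 'I_K) =>
    pr P (xi @^-1` D (m N) j) * pr P (xi @^-1` Q (m N) j) ^+ (m N).-1)) /=.
  by rewrite sumr_const card_ord -mulr_natl mulr_sumr.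
have prF N : pr P (F N) = binomial_tail (p N) (n N) (Num.truncn ((n N)%:R * q)).+1.
  apply: pr_few_block_events => //.
  - exact: pr_rectangle.
  - by move=> i _; exact: group_seq_uniq.
  - exact: group_seq_disjoint.
  - exact: tV.
  - exact: sV.
pose u N := expR (e / 2 / 2) * expR (- ((e / 2) ^+ 2 / 4 * (n N)%:R)).
have mF N : measurable (F N) by apply: measurable_few_block_events.
have Fu : \forall N \near \oo, (P (F N) <= (u N)%:E)%E.
  have : \forall N \near \oo, fine (sigma B) / fine (sigma setT) - e / 2 <= p N.
    case: lowp => M _ hM; apply: filterS (group_size_large M r0 r1) => N MN.
    exact: hM.
  apply: filterS2 (nbhs_infty_gt 0%N) => N N0 pN.
  rewrite (prE P (mF N)) lee_fin prF; apply: binomial_tail_chernoff => //.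
    (* That [p N] lies in [[0, 1]] is seen by identifying it with the probability of the block event
       of group 0. *)
    have n0 : (0 < n N)%N by exact: nb_groups_gt0.
    rewrite -(sV N 0%N n0) sumr_ge0 => [|t _]; last exact: pr_ge0.
    rewrite -pr_bigcup; last exact: tV.
      by apply: pr_le1; apply: measurable_block_event.
    by move=> t; apply: measurable_rectangle.
  by rewrite /q; lra.
have su : (\sum_(N <oo) (u N)%:E < +oo)%E.
  have -> : (\sum_(N <oo) (u N)%:E = (expR (e / 2 / 2))%:E *
      \sum_(N <oo) (expR (- ((e / 2) ^+ 2 / 4 * (n N)%:R)))%:E)%E.
    rewrite -nneseriesZl => [|k _]; first exact: eq_eseriesr.
    by rewrite lee_fin expR_ge0.
  rewrite lte_mul_pinfty ?lee_fin ?expR_ge0 //.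
  by apply: summable_exp_nb_groups => //; rewrite divr_gt0 // exprn_gt0.
have u0 N : 0 <= u N by rewrite mulr_ge0 ?expR_ge0.
apply: filterS (ae_eventually_notin mF u0 su Fu) => w.
apply: filterS2 (nbhs_infty_gt 0%N) => N N0 wF.
have n0 : 0 < (n N)%:R :> R by rewrite ltr0n nb_groups_gt0.
rewrite sigma_hatE mulrC ler_pdivlMr // -/(n N) mulrC.
move/negP: wF; rewrite -leqNgt => wF.
apply: (le_trans (ltW (truncnS_gt _))).
rewrite -[X in _ <= X]natr_sum ler_nat; apply: (leq_trans wF).
apply: leq_sum => i _; case: (boolP (w \in _)) => // /set_mem[t _ wt].
rewrite mem_set //; apply: (winner_direction _ _ _ wt).
- exact: DQ.
- by move=> j x; exact: DB.
- exact: size_group_seq.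
Qed.

End empirical_lower_bound.

Theorem corollary2p7 (R : realType) (d : nat) (alpha : R)
  (sigma : {finite_measure set (borel (sphere R d)) -> \bar R})
  (disp : measure_display) (Omega : measurableType disp)
  (P : probability Omega R)
  (xi : {RV P >-> borel 'rV[R]_d.+1})
  (xi_ : nat -> {RV P >-> borel 'rV[R]_d.+1})
  (r : R) (s0 : sphere R d)
  (G : forall N : nat, nat -> {set 'I_N}) :
  0 < alpha ->
  sigma [set: borel (sphere R d)] <> 0%E ->
  mutually_independent xi_ ->
  (forall j : nat, identically_distributed (xi_ j) xi) ->
  regularly_varying xi alpha sigma ->
  0 < r -> r < 1 ->
  (forall N : nat, is_grouping (nb_groups r N) (group_size r N) (G N)) ->
  {ae P, forall w : Omega,
    weak_cvg (fun N : nat => sigma_hat s0 r (G N) (fun j : nat => xi_ j w))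
             (sigma_tilde sigma)}.
Proof.
move=> alpha0 sigma0 indep ident rv r0 r1 grouping.
have [a a12 aP] := exists_offset sigma.
(* Errors [1 / (j + 1)], countably many meshes and finitely many cells for each: one null set serves
   them all. *)
have cells : {ae P, forall w, forall (j k : nat) (c : cell_index (d:=d) k),
    \forall N \near \oo, fine (sigma (@cell R d a k c)) / fine (sigma setT) - j.+1%:R^-1 <=
    fine (sigma_hat s0 r (G N) (fun j => xi_ j w) (@cell R d a k c))}.
  apply: ae_foralln => j; apply: ae_foralln => k; apply: filter_forall => c.
  apply: (sigma_hat_lower_bound (alpha := alpha) (xi := xi)) => //.
  - exact: measurable_cell.
  - by apply: sigma_boundary_cell => z i; exact: aP.
apply: filterS cells => w h.
apply: (weak_cvg_of_cells a12).
- exact: probability_setT.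
- apply: filterS (nbhs_infty_gt 0%N) => N N0.
  by apply: sigma_hat_setT; exact: nb_groups_gt0.
- move=> k c eta eta0.
  have tildeE : fine (sigma_tilde sigma (@cell R d a k c)) =
      fine (sigma (@cell R d a k c)) / fine (sigma setT).
    rewrite /sigma_tilde /= /mnormalize.
    have fT : sigma setT \is a fin_num by exact: fin_num_measure.
    have -> : (sigma setT == 0%E) || (sigma setT == +oo%E) = false.
      by apply/negbTE; rewrite negb_or; apply/andP; split; [exact/eqP|move: fT; rewrite fin_numE => /andP[]].
    by rewrite fineM // fin_num_measure //; exact: measurable_cell.
  (* This index [j] gives [1 / (j + 1) <= eta]. *)
  apply: filterS (h (Num.truncn eta^-1) k c) => N; apply: le_trans.
  rewrite tildeE lerD2l lerN2 invf_ple ?posrE ?ltr0n //.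
  exact/ltW/truncnS_gt.
Qed.
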